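(* There exist positive constants $c_3,c_2$ such that for every positive integer $n$, $$R(n)\le\tfrac12-c_3n^{-5/2},\qquad R^p(n)\le\tfrac{2}{\pi}-c_2n^{-4}.$$ Consequently there is a constant $c>0$ such that for every $r\in[0,\tfrac12)$, $$\gamma(\omega_r)\ge N(r)> c\left(\tfrac12-r\right)^{-2/5}.$$
   Context: Qubit POVM: finite family $\{\Pi_i\}_{i=1}^n$ of positive semidefinite operators summing to $\mathbb{I}$; it simulates $\{M_{a|x}\}$ if $M_{a|x}=\sum_i p(a|x,i)\Pi_i$ with $p(a|x,i)\ge0$, $\sum_a p(a|x,i)=1$. $\mathcal{P}_r$: the two-outcome POVMs $\{\tfrac12(\mathbb{I}\pm r\hat n\cdot\vec\sigma)\}$ over all unit $\hat n\in\mathbb{R}^3$; $\mathcal{P}^p_r$: subfamily with $\hat n=(n_x,0,n_z)$. $R(n)$ (resp. $R^p(n)$): supremum of $r$ such that some $n$-outcome qubit POVM simulates $\mathcal{P}_r$ (resp. $\mathcal{P}^p_r$). $N(r)$: smallest $n$ such that some $n$-outcome qubit POVM simulates $\mathcal{P}_r$ ($+\infty$ if none). $\omega_r=r|\Psi^-\rangle\langle\Psi^-|+(1-r)\mathbb{I}\otimes\mathbb{I}/4$. The assemblage generated from $\rho_{AB}$ by POVMs $\{M_{a|x}\}$ on $A$ is $\sigma_{a|x}=\mathrm{Tr}_A[(M_{a|x}\otimes\mathbb{I})\rho_{AB}]$; an LHS model of size $n$ is a distribution $p(i)$ on $\{1,\dots,n\}$, states $\rho_i$ on $B$, and $p(a|x,i)$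 with $\sigma_{a|x}=\sum_{i=1}^n p(a|x,i)p(i)\rho_i$. $\gamma(\rho_{AB})$: smallest $n$ such that every assemblage generated from $\rho_{AB}$ by any family of POVMs on $A$ admits an LHS model of size $n$. *)

(* Defs.v *)
From mathcomp Require Import all_boot all_order all_algebra.
From mathcomp Require Import all_classical all_reals all_analysis.
From mathcomp Require Import complex mxtens.
Set Implicit Arguments. Unset Strict Implicit. Unset Printing Implicit Defensive.
Import Order.TTheory GRing.Theory Num.Theory.
Local Open Scope ring_scope.
Local Open Scope classical_set_scope.
Local Open Scope complex_scope.

Section Qubits.
Variable R : realType.
Local Notation C := (R[i]).

Definition adj {m n} (A : 'M[C]_(m, n)) : 'M[C]_(n, m) := (map_mx Num.conj A)^T.

(* positive semidefinite: <v|A|v> >= 0 for every vector v (order of C: real and >= 0) *)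
Definition psd {m} (A : 'M[C]_m) : Prop :=
  forall v : 'cV[C]_m, 0 <= (adj v *m A *m v) 0 0.

Definition is_state {m} (rho : 'M[C]_m) : Prop := psd rho /\ \tr rho = 1.

Definition qubit_povm (I : finType) (M : I -> 'M[C]_2) : Prop :=
  (forall i, psd (M i)) /\ \sum_(i : I) M i = 1%:M.

Definition simulates (n : nat) (Pi : 'I_n -> 'M[C]_2)
  (X : Type) (A : finType) (M : X -> A -> 'M[C]_2) : Prop :=
  exists p : X -> A -> 'I_n -> R,
    (forall x a i, 0 <= p x a i) /\
    (forall x i, \sum_(a : A) p x a i = 1) /\
    (forall x a, M x a = \sum_(i < n) (p x a i)%:C *: Pi i).

(* n . sigma = nx sigma_x + ny sigma_y + nz sigma_z *)
Definition ndotsigma (nx ny nz : R) : 'M[C]_2 :=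
  \matrix_(j < 2, k < 2)
    if (j == 0 :> nat) then
      (if (k == 0 :> nat) then nz%:C else nx%:C - 'i * ny%:C)
    else
      (if (k == 0 :> nat) then nx%:C + 'i * ny%:C else - nz%:C).

Definition Pr_elem (r nx ny nz : R) (b : bool) : 'M[C]_2 :=
  2^-1 *: (1%:M + ((if b then 1 else -1) * r)%:C *: ndotsigma nx ny nz).

Definition unit_vec := {v : R * R * R | v.1.1 ^+ 2 + v.1.2 ^+ 2 + v.2 ^+ 2 = 1}.
Definition unit_vec_xz := {v : R * R | v.1 ^+ 2 + v.2 ^+ 2 = 1}.

Definition Pfam (r : R) (v : unit_vec) (b : bool) : 'M[C]_2 :=
  Pr_elem r (sval v).1.1 (sval v).1.2 (sval v).2 b.
Definition Pfam_p (r : R) (v : unit_vec_xz) (b : bool) : 'M[C]_2 :=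
  Pr_elem r (sval v).1 0 (sval v).2 b.

Definition simulable (n : nat) (r : R) : Prop :=
  exists Pi : 'I_n -> 'M[C]_2, qubit_povm Pi /\ simulates Pi (Pfam r).
Definition simulable_p (n : nat) (r : R) : Prop :=
  exists Pi : 'I_n -> 'M[C]_2, qubit_povm Pi /\ simulates Pi (Pfam_p r).

Definition Rn (n : nat) : R := sup [set r | simulable n r].
Definition Rpn (n : nat) : R := sup [set r | simulable_p n r].

(* N(r) : least n, or +oo if none *)
Definition Nr (r : R) : \bar R :=
  ereal_inf [set ((n%:R : R)%:E) | n in [set n : nat | simulable n r]].

(* two-qubit states: 'M_(2*2) with the Kronecker (tensmx) ordering, A first *)
Definition ket (i : 'I_2) : 'cV[C]_2 := delta_mx i 0.
Definition psi_minus : 'cV[C]_(2 * 2) :=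
  ((Num.sqrt (2 : R))^-1)%:C *: (ket 0 *t ket 1 - ket 1 *t ket 0).
Definition omega (r : R) : 'M[C]_(2 * 2) :=
  r%:C *: (psi_minus *m adj psi_minus) + ((1 - r) / 4)%:C *: 1%:M.

Definition ptraceA (Y : 'M[C]_(2 * 2)) : 'M[C]_2 :=
  \sum_(i < 2) ((adj (ket i) *t (1%:M : 'M[C]_2)) *m Y *m (ket i *t (1%:M : 'M[C]_2))).

Definition assemblage (rho : 'M[C]_(2 * 2)) (X : Type) (A : finType)
  (M : X -> A -> 'M[C]_2) (x : X) (a : A) : 'M[C]_2 :=
  ptraceA ((M x a *t (1%:M : 'M[C]_2)) *m rho).

Definition has_LHS (n : nat) (X : Type) (A : finType)
  (sigma : X -> A -> 'M[C]_2) : Prop :=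
  exists (p : 'I_n -> R) (rho : 'I_n -> 'M[C]_2) (q : X -> A -> 'I_n -> R),
    (forall i, 0 <= p i) /\ \sum_(i < n) p i = 1 /\
    (forall i, is_state (rho i)) /\
    (forall x a i, 0 <= q x a i) /\
    (forall x i, \sum_(a : A) q x a i = 1) /\
    (forall x a, sigma x a = \sum_(i < n) (q x a i * p i)%:C *: rho i).

Definition gamma (rho : 'M[C]_(2 * 2)) : \bar R :=
  ereal_inf [set ((n%:R : R)%:E) | n in
    [set n : nat | forall (X : Type) (A : finType) (M : X -> A -> 'M[C]_2),
        (forall x, qubit_povm (M x)) -> has_LHS n (assemblage rho M)]].

End Qubits.

(* Main.v *)
Require Import Defs.
From mathcomp Require Import all_boot all_order all_algebra.
From mathcomp Require Import all_classical all_reals all_analysis.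
From mathcomp Require Import complex mxtens.
From mathcomp Require Import zify ring lra.
Set Implicit Arguments. Unset Strict Implicit. Unset Printing Implicit Defensive.
Import Order.TTheory GRing.Theory Num.Theory.
Import numFieldNormedType.Exports.
Local Open Scope ring_scope.

(* If n effects alpha_i (1 + v_i . sigma) simulate P_r, then r <= h(y) for every unit vector y,
   where h(y) = sum_i alpha_i |v_i . y|. On the sphere h has mean at most 1/2, and on the circle
   mean at most 2/pi, which bounds r by these constants. To gain something, let y lie at angular
   distance at least delta from the n kinks v_i^perp of h: rotating y by +delta and by -delta
   crosses no kink, so 2 cos(delta) h(y) is the sum of two values of h, hence at least 2 r, and
   h(y) >= r / cos(delta). For delta of order 1/n such y fill a fixed proportion of the sphere, so
   averaging h gives 1/2 - r >= c / n^2, and similarly on the circle; this is stronger than the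
   claimed n^(-5/2) and n^(-4). Finally, a local hidden state model for the singlet mixed with
   white noise under projective measurements becomes, after rescaling the hidden states, a POVM
   simulating P_r with the same number of outcomes, whence N(r) <= gamma. *)

(** * Moments on the unit interval, the circle and the sphere *)

Section Moments.
Variable R : realType.
Implicit Types (f g : R -> R) (c d x : R) (p : {poly R}).

(** The integral over [0, 1] is encoded as the increment of a primitive on the whole line: linearity
    comes from the rules of derivation, monotonicity from the mean value theorem. *)
Definition integral01 f c :=
  exists F : R -> R, (forall x, is_derive x 1 F (f x)) /\ c = F 1 - F 0.

Lemma integral01_ext f g c : f =1 g -> integral01 f c -> integral01 g c.
Proof. by move=> /funext ->. Qed.

Lemma integral01D f g c d :
  integral01 f c -> integral01 g d -> integral01 (fun x => f x + g x) (c + d).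
Proof.
move=> [F [dF ->]] [G [dG ->]]; exists (F + G); split; last by rewrite !fctE; ring.
by move=> x; apply: is_deriveD.
Qed.

Lemma integral01Z a f c : integral01 f c -> integral01 (fun x => a * f x) (a * c).
Proof.
move=> [F [dF ->]]; exists (a *: F); split; last first.
  by rewrite !fctE /GRing.scale /=; ring.
by move=> x; apply: is_deriveZ.
Qed.

Lemma integral01B f g c d :
  integral01 f c -> integral01 g d -> integral01 (fun x => f x - g x) (c - d).
Proof.
move=> If Ig; rewrite -[- d]mulN1r.
by apply: integral01_ext (integral01D If (integral01Z (-1) Ig)) => x; rewrite mulN1r.
Qed.

Lemma integral01_sum (I : Type) (s : seq I) (P : pred I) (f : I -> R -> R) (c : I -> R) :
  (forall i, integral01 (f i) (c i)) ->
  integral01 (fun x => \sum_(i <- s | P i) f i x) (\sum_(i <- s | P i) c i).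
Proof.
move=> If; elim: s => [|i s IHs].
  rewrite big_nil; exists (cst 0); split; last by rewrite subrr.
  by move=> x; rewrite big_nil; apply: is_derive_cst.
rewrite big_cons; case: ifP => Pi.
  by apply: integral01_ext (integral01D (If i) IHs) => x; rewrite big_cons Pi.
by apply: integral01_ext IHs => x; rewrite big_cons Pi.
Qed.

Lemma integral01_expn n : integral01 (fun x => x ^+ n) (n.+1%:R)^-1.
Proof.
exists (n.+1%:R^-1 *: (id : R -> R) ^+ n.+1); split.
  move=> x; apply: is_derive_eq.
  by rewrite /GRing.scale /= mulr1 mulrA mulVf ?mul1r // pnatr_eq0.
by rewrite !fctE /GRing.scale /= expr1n expr0n /=; ring.
Qed.

Lemma integral01_le f g c d : (forall x, 0 <= x <= 1 -> f x <= g x) ->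
  integral01 f c -> integral01 g d -> c <= d.
Proof.
move=> fg If Ig; rewrite -subr_ge0.
have [H [dH ->]] := integral01B Ig If.
have Hc : {within `[0, 1], continuous H}%classic.
  by apply: derivable_within_continuous => x _; case: (dH x).
have [z] := MVT_segment ler01 (fun x _ => dH x) Hc.
rewrite in_itv /= => /fg fgz ->; rewrite subr0 mulr1; lra.
Qed.

(** Half the Beta function at (l + 1/2, j + 1), unfolded by its recursion in j. *)
Fixpoint beta_moment (j l : nat) : R :=
  if j is j'.+1 then beta_moment j' l * (2 * j'.+1)%:R / (2 * l + 2 * j' + 3)%:R
  else (2 * l + 1)%:R^-1.

Lemma beta_momentS j l :
  beta_moment j l.+1 = beta_moment j l * (2 * l + 1)%:R / (2 * l + 2 * j + 3)%:R.
Proof.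
elim: j => [|j IHj] /=.
  have -> : (2 * l.+1 + 1 = 2 * l + 2 * 0 + 3)%N by lia.
  by rewrite mulVf ?mul1r // pnatr_eq0; lia.
rewrite IHj.
have -> : (2 * l.+1 + 2 * j + 3 = 2 * l + 2 * j.+1 + 3)%N by lia.
by field; do ?[apply/andP; split]; apply: lt0r_neq0; have := ler0n R l; have := ler0n R j; lra.
Qed.

(** Induction on j for all l at once: a factor 1 - t^2 splits the integral into those at l and l +
    1. *)
Lemma integral01_beta j l :
  integral01 (fun t => t ^+ (2 * l) * (1 - t ^+ 2) ^+ j) (beta_moment j l).
Proof.
elim: j l => [|j IHj] l.
  rewrite /= addn1; apply: integral01_ext (integral01_expn _) => t.
  by rewrite expr0 mulr1.
have -> : beta_moment j.+1 l = beta_moment j l - beta_moment j l.+1.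
  rewrite beta_momentS /=.
  by field; do ?[apply/andP; split]; apply: lt0r_neq0; have := ler0n R l; have := ler0n R j; lra.
apply: integral01_ext (integral01B (IHj l) (IHj l.+1)) => t.
by rewrite mulnS exprD [_ ^+ j.+1]exprS; ring.
Qed.

(** A Wallis-type bound; the induction step amounts to 4 (m + 1) (m + 2) <= (2 m + 3)^2. *)
Lemma beta_moment_sqr m : beta_moment m 0 ^+ 2 <= m.+1%:R^-1.
Proof.
elim: m => [|m IHm] /=; first by rewrite invr1 expr1n.
rewrite muln0 add0n expr_div_n exprMn.
have m0 : 0 <= m%:R :> R by [].
apply: (@le_trans _ _ (m.+1%:R^-1 * (2 * m.+1)%:R ^+ 2 / (2 * m + 3)%:R ^+ 2)).
  by rewrite !ler_pM2r// ?invr_gt0 exprn_gt0// ltr0n; lia.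
rewrite ler_pdivrMr ?exprn_gt0 ?ltr0n ?addn3//.
rewrite [leRHS]mulrC ler_pdivlMr ?ltr0n// -mulrA ler_pdivrMl ?ltr0n//.
rewrite -addn3 !natrD !natrM -[m.+2]addn2 -addn1 !natrD; nra.
Qed.

(** Turns the weights of the integrated slice moments into plain binomial coefficients, which the
    binomial theorem can sum. *)
Lemma beta_moment_binomial i l :
  ('C(2 * (l + i), 2 * i) * 'C(2 * i, i))%:R * beta_moment i l
    = 4 ^+ i * 'C(l + i, i)%:R / (2 * (l + i) + 1)%:R.
Proof.
have fact_neq0 n : n`!%:R != 0 :> R by rewrite pnatr_eq0 -lt0n fact_gt0.
have binE n k : 'C(n + k, k)%:R = (n + k)`!%:R / (k`!%:R * n`!%:R) :> R.
  apply: (canRL (mulfK _)); first by rewrite mulf_neq0.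
  by rewrite -!natrM -[in RHS](bin_fact (leq_addl n k)) addnK.
have -> : (2 * (l + i) = 2 * l + 2 * i)%N by lia.
have C2 : 'C(2 * i, i)%:R = (2 * i)`!%:R / (i`!%:R * i`!%:R) :> R.
  by rewrite mul2n -addnn binE.
rewrite natrM !binE.
rewrite {}C2; elim: i => [|i IHi].
  rewrite /= !muln0 !addn0 fact0; field.
  rewrite !fact_neq0 /=; have := ler0n R l => ?.
  by rewrite ?andbT ?oner_neq0 /=; apply: lt0r_neq0; lra.
have E : (2 * l + 2 * i.+1)%N = (2 * l + 2 * i).+2 by lia.
have E' : (2 * i.+1)%N = (2 * i).+2 by lia.
have E3 : (2 * l + 2 * i.+1 + 1 = 2 * l + 2 * i + 3)%N by lia.
rewrite E3 [in (2 * l + 2 * i.+1)`!]E [in (2 * i.+1)`!]E' addnS !factS !natrM /=.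
set B := beta_moment i l in IHi *.
have -> : B = 4 ^+ i * ((l + i)`!%:R / (i`!%:R * l`!%:R)) / (2 * l + 2 * i + 1)%:R /
   ((2 * l + 2 * i)`!%:R / ((2 * i)`!%:R * (2 * l)`!%:R) * ((2 * i)`!%:R / (i`!%:R * i`!%:R))).
  rewrite -IHi mulrC mulKf // !mulf_neq0 ?invr_neq0 ?mulf_neq0 //.
rewrite exprS; field.
rewrite !fact_neq0 /=.
do ?[apply/andP; split]; apply: lt0r_neq0; have := ler0n R l; have := ler0n R i; lra.
Qed.

End Moments.

(** * Moments of a linear form over the vertices of a regular polygon *)

Section CircleMoments.
Variable R : realType.
Local Open Scope complex_scope.
Local Notation C := R[i].

Definition cis (t : R) : C := Complex (cos t) (sin t).

Lemma cisD s t : cis (s + t) = cis s * cis t.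
Proof.
by apply/eqP; rewrite eq_complex /= cosD sinD [_ + cos s * _]addrC !eqxx.
Qed.

Lemma cis_exp t n : cis t ^+ n = cis (n%:R * t).
Proof.
elim: n => [|n IHn]; first by rewrite mul0r /cis cos0 sin0.
by rewrite exprS IHn -cisD mulrSr mulrDl mul1r addrC.
Qed.

Lemma cis_neq1 t : 0 < `|t| < pi -> cis (2 * t) != 1.
Proof.
move=> /andP[t0 tpi]; apply/negP => /eqP[].
rewrite mulr_natl cos_mulr2n => cos1 _.
have : sin `|t| ^+ 2 = 0 by rewrite sin2cos2 cos_norm; lra.
by move/eqP; rewrite sqrf_eq0 gt_eqF // sin_gt0_pi // t0.
Qed.

Definition root_angle (N k : nat) : R := k%:R * (2 * pi / N%:R).

(** A geometric sum with ratio w = exp(2 pi i (m - 2i) / N), where the i in front is the imaginary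
    unit. As |m - 2i| <= m < N, the root of unity w equals 1 only if m = 2i. *)
Lemma cis_sum N m i : (m < N)%N -> (i <= m)%N ->
  \sum_(k < N) cis (root_angle N k) ^+ (m - i) * cis (- root_angle N k) ^+ i
    = if (2 * i == m)%N then N%:R else 0.
Proof.
move=> mN im.
have N0 : N%:R != 0 :> R by rewrite pnatr_eq0; lia.
pose e : R := m%:R - 2 * i%:R.
have termE k : cis (root_angle N k) ^+ (m - i) * cis (- root_angle N k) ^+ i
    = cis (2 * (pi * e / N%:R)) ^+ k.
  rewrite !cis_exp -cisD /root_angle /e natrB //; congr cis; ring.
under eq_bigr do rewrite termE.
case: eqP => [im2|im2].
  rewrite /e -im2 natrM subrr mulr0 mul0r mulr0 /cis cos0 sin0.
  under eq_bigr do rewrite expr1n.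
  by rewrite sumr_const card_ord.
set w := cis _; have w1 : w != 1.
  apply: cis_neq1; have pi0 := pi_gt0 R.
  have e0 : e != 0 by rewrite subr_eq0 -natrM eqr_nat; lia.
  have N0' : 0 < N%:R :> R by rewrite ltr0n; lia.
  rewrite normrM normfV normr_nat normrM (gtr0_norm pi0) divr_gt0 ?mulr_gt0 ?normr_gt0 //=.
  rewrite ltr_pdivrMr // ltr_pM2l // ltr_norml /e.
  have : (m.+1%:R <= N%:R :> R) by rewrite ler_nat.
  have : (i%:R <= m%:R :> R) by rewrite ler_nat.
  rewrite -natr1; have := ler0n R i; have := ler0n R m => *.
  by apply/andP; split; lra.
have wN : w ^+ N = 1.
  rewrite /w cis_exp.
  have -> : N%:R * (2 * (pi * e / N%:R)) = (m%:R - 2 * i%:R) * (2 * pi).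
    by rewrite /e; field.
  have cis2pi n : cis (n%:R * (2 * pi)) = 1.
    by rewrite -cis_exp /cis mulr_natl cos2pi sin2pi expr1n.
  have := cis2pi m; rewrite -{1}[m%:R](subrK (2 * i%:R)) mulrDl cisD.
  by rewrite -natrM cis2pi mulr1.
apply/eqP; have := subrX1 w N; rewrite wN subrr => /esym/eqP.
by rewrite mulf_eq0 subr_eq0 (negbTE w1).
Qed.

(** With w = a + i b the linear form is half of conj(w) exp(i t) + w exp(- i t); its binomial
    expansion is summed over the polygon by [cis_sum], so only the middle term can survive. *)
Lemma circle_moment_expansion N m (a b : R) : (m < N)%N ->
  (\sum_(k < N) (a * cos (root_angle N k) + b * sin (root_angle N k)) ^+ m)%:C
    = 2 ^- m * \sum_(i < m.+1) (Complex a (- b) ^+ (m - i) * Complex a b ^+ i *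
         (if (2 * i == m)%N then N%:R else 0)) *+ 'C(m, i).
Proof.
move=> mN; rewrite rmorph_sum /=.
have linE t : (a * cos t + b * sin t)%:C
    = 2^-1 * (Complex a (- b) * cis t + Complex a b * cis (- t)).
  rewrite /cis cosN sinN; apply: (mulfI (_ : 2 != 0 :> C)); first by rewrite pnatr_eq0.
  rewrite mulrA mulfV ?pnatr_eq0 // mul1r mulr_natl.
  by apply/eqP; rewrite eq_complex /=; apply/andP; split; apply/eqP; ring.
under eq_bigr do rewrite rmorphXn /= linE exprMn exprDn big_distrr /=.
rewrite exchange_big /= big_distrr /=; apply: eq_bigr => i _.
rewrite -(cis_sum mN (leq_ord i)).
rewrite !big_distrr /= -sumrMnl big_distrr /=; apply: eq_bigr => k _.
by rewrite exprVn !exprMn; ring.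
Qed.

Lemma circle_moment_odd N m (a b : R) : (m < N)%N -> odd m ->
  \sum_(k < N) (a * cos (root_angle N k) + b * sin (root_angle N k)) ^+ m = 0.
Proof.
move=> mN om; apply: complexI; rewrite circle_moment_expansion //.
rewrite big1 ?mulr0 // => i _; rewrite ifF ?mulr0 ?mul0rn //.
by apply/negbTE; move: om; apply: contraL => /eqP <-; rewrite oddM.
Qed.

Lemma circle_moment_even N l (a b : R) : (2 * l < N)%N ->
  \sum_(k < N) (a * cos (root_angle N k) + b * sin (root_angle N k)) ^+ (2 * l)
   = N%:R * ('C(2 * l, l)%:R / 4 ^+ l * (a ^+ 2 + b ^+ 2) ^+ l).
Proof.
move=> lN; apply: complexI; rewrite circle_moment_expansion //.
have l2 : (l < (2 * l).+1)%N by lia.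
rewrite (bigD1 (Ordinal l2)) //= eqxx big1 ?addr0; last first.
  move=> i /eqP il; rewrite ifF ?mulr0 ?mul0rn //.
  by apply/negbTE/eqP => E; apply: il; apply: val_inj => /=; lia.
have -> : (2 * l - l = l)%N by lia.
have normE : Complex a (- b) * Complex a b = (a ^+ 2 + b ^+ 2)%:C.
  by apply/eqP; rewrite eq_complex /=; apply/andP; split; apply/eqP; ring.
rewrite -exprMn normE !rmorphM !rmorphXn /= fmorphV /= !rmorphXn !rmorph_nat.
rewrite exprM -natrX -[_ *+ 'C(_, _)]mulr_natr.
by ring.
Qed.

End CircleMoments.

(** * Averages over the sphere of even polynomials in a linear form *)

Section SphereAverage.
Variable R : realType.
Implicit Types (z : R) (u v y : R * R * R) (q : {poly R}).

Definition dot3 u v : R := u.1.1 * v.1.1 + u.1.2 * v.1.2 + u.2 * v.2.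

Definition sphere_point (N k : nat) z : R * R * R :=
  (Num.sqrt (1 - z ^+ 2) * cos (root_angle R N k),
   Num.sqrt (1 - z ^+ 2) * sin (root_angle R N k), z).

Lemma sphere_point_unit N k z : 0 <= z <= 1 ->
  dot3 (sphere_point N k z) (sphere_point N k z) = 1.
Proof.
move=> z01; have : 0 <= 1 - z ^+ 2 by nra.
move/sqr_sqrtr; have := cos2Dsin2 (root_angle R N k).
rewrite /dot3 /=; set s := Num.sqrt _; set c := cos _; set d := sin _ => cd ss.
transitivity (s ^+ 2 * (c ^+ 2 + d ^+ 2) + z ^+ 2); first ring.
rewrite cd ss; ring.
Qed.

Lemma sum_even_terms (F : nat -> R) l : (forall i, odd i -> F i = 0) ->
  \sum_(i < (2 * l).+1) F i = \sum_(i < l.+1) F (2 * i)%N.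
Proof.
move=> F0; elim: l => [|l IHl]; first by rewrite !big_ord_recl !big_ord0.
have -> : (2 * l.+1 = (2 * l).+2)%N by lia.
rewrite big_ord_recr /= big_ord_recr /= IHl [RHS]big_ord_recr /=.
rewrite [F (2 * l).+1]F0 ?addr0; last by rewrite /= oddM.
by congr (_ + F _); lia.
Qed.

(** Expand the power of the vertical plus the horizontal part of the dot product. Odd horizontal
    moments vanish, so the radius sqrt(1 - z^2) occurs only in even powers and a polynomial in z
    remains. *)
Lemma slice_moment N l u z : (2 * l < N)%N -> 0 <= z <= 1 ->
  N%:R^-1 * \sum_(k < N) dot3 u (sphere_point N k z) ^+ (2 * l)
   = \sum_(i < l.+1) ('C(2 * l, 2 * i) * 'C(2 * i, i))%:R / 4 ^+ i
       * (u.1.1 ^+ 2 + u.1.2 ^+ 2) ^+ i * u.2 ^+ (2 * (l - i))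
       * (z ^+ (2 * (l - i)) * (1 - z ^+ 2) ^+ i).
Proof.
move=> lN z01; have N0 : N%:R != 0 :> R by rewrite pnatr_eq0; lia.
apply: (mulfI N0); rewrite mulrA mulfV // mul1r.
set s := Num.sqrt (1 - z ^+ 2).
have s2 : s ^+ 2 = 1 - z ^+ 2 by rewrite sqr_sqrtr //; nra.
pose F i := 'C(2 * l, i)%:R * (u.2 * z) ^+ (2 * l - i) * s ^+ i
  * \sum_(k < N) (u.1.1 * cos (root_angle R N k) + u.1.2 * sin (root_angle R N k)) ^+ i.
transitivity (\sum_(i < (2 * l).+1) F i).
  rewrite /F; under [RHS]eq_bigr do rewrite big_distrr /=.
  rewrite exchange_big /=; apply: eq_bigr => k _.
  have -> : dot3 u (sphere_point N k z) = u.2 * z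
      + s * (u.1.1 * cos (root_angle R N k) + u.1.2 * sin (root_angle R N k)).
    by rewrite /dot3 /= -/s; ring.
  rewrite exprDn; apply: eq_bigr => i _.
  by rewrite [(s * _) ^+ i]exprMn -mulr_natl; ring.
have -> : \sum_(i < (2 * l).+1) F i
    = \sum_(i < (2 * l).+1) (if odd i then 0 else F i).
  apply: eq_bigr => i _; case: ifP => // oi.
  rewrite /F circle_moment_odd ?mulr0 //; have := ltn_ord i; lia.
rewrite (sum_even_terms _ (F := fun i => if odd i then 0 else F i)); last by move=> i ->.
rewrite big_distrr /=; apply: eq_bigr => i _.
rewrite oddM /= /F circle_moment_even; last by have := ltn_ord i; lia.
by rewrite -mulnBr [s ^+ (2 * i)]exprM s2 [(u.2 * z) ^+ _]exprMn natrM; ring.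
Qed.

(** By [beta_moment_binomial] the integrated terms are those of the binomial expansion of (u . u)^l
    = 1, divided by 2 l + 1. *)
Lemma integral_slice_moment l u : dot3 u u = 1 ->
  integral01 (fun z => \sum_(i < l.+1) ('C(2 * l, 2 * i) * 'C(2 * i, i))%:R / 4 ^+ i
       * (u.1.1 ^+ 2 + u.1.2 ^+ 2) ^+ i * u.2 ^+ (2 * (l - i))
       * (z ^+ (2 * (l - i)) * (1 - z ^+ 2) ^+ i)) (2 * l + 1)%:R^-1.
Proof.
move=> u1; have -> : (2 * l + 1)%:R^-1 = \sum_(i < l.+1)
    ('C(2 * l, 2 * i) * 'C(2 * i, i))%:R / 4 ^+ i
       * (u.1.1 ^+ 2 + u.1.2 ^+ 2) ^+ i * u.2 ^+ (2 * (l - i)) * beta_moment R i (l - i).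
  have := exprDn (u.2 ^+ 2) (u.1.1 ^+ 2 + u.1.2 ^+ 2) l.
  have -> : u.2 ^+ 2 + (u.1.1 ^+ 2 + u.1.2 ^+ 2) = 1 by rewrite -u1 /dot3; ring.
  rewrite expr1n => /(congr1 (fun t => (2 * l + 1)%:R^-1 * t)); rewrite mulr1 => ->.
  rewrite big_distrr /=; apply: eq_bigr => i _.
  have := beta_moment_binomial R i (l - i); rewrite subnK; last by have := ltn_ord i; lia.
  move=> E; set A := (u.1.1 ^+ 2 + u.1.2 ^+ 2) ^+ i; set B := u.2 ^+ (2 * (l - i)).
  rewrite -!mulrA mulrC [(4 ^+ i)^-1 * _]mulrC -!mulrA.
  transitivity (A * B / 4 ^+ i * (('C(2 * l, 2 * i) * 'C(2 * i, i))%:R * beta_moment R i (l - i))); last by ring.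
  rewrite E -mulr_natr /B exprM -/A; field.
  rewrite expf_neq0 //= ?andbT; apply: lt0r_neq0; have := ler0n R l; lra.
by apply: integral01_sum => i; apply: integral01Z; apply: integral01_beta.
Qed.

Definition even_moment q : R := \sum_(l < size q) q`_l * (2 * l + 1)%:R^-1.

Lemma integral_even_moment q : integral01 (fun t => q.[t ^+ 2]) (even_moment q).
Proof.
have := @integral01_sum R 'I_(size q) (index_enum _) xpredT
  (fun l t => q`_l * t ^+ (2 * l)) (fun l => q`_l * (2 * l + 1)%:R^-1).
move=> /(_ _)/integral01_ext; apply.
  by move=> t; rewrite horner_coef; apply: eq_bigr => l _; rewrite exprM.
by move=> l; apply: integral01Z; rewrite addn1; apply: integral01_expn.
Qed.

(* The average over the sphere of [y |-> q ((u . y)^2)] is the integral of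
   [t |-> q (t^2)] over [0, 1] (Archimedes): it is computed on horizontal
   slices, each averaged over the vertices of a regular polygon. *)
Lemma sphere_average (n : nat) (q : 'I_n -> {poly R}) (u : 'I_n -> R * R * R) (c : R) :
  (forall i, dot3 (u i) (u i) = 1) ->
  (forall y, dot3 y y = 1 -> c <= \sum_(i < n) (q i).[dot3 (u i) y ^+ 2]) ->
  c <= \sum_(i < n) even_moment (q i).
Proof.
move=> u1 cle.
(* One polygon with enough vertices to compute the moments of all the [q i] exactly. *)
pose N := (\sum_(i < n) 2 * size (q i)).+1.
have szN i : (2 * size (q i) < N)%N.
  by rewrite /N (bigD1 i) //= ltnS leq_addr.
pose G i z := \sum_(l < size (q i)) (q i)`_l * \sum_(j < l.+1)
   ('C(2 * l, 2 * j) * 'C(2 * j, j))%:R / 4 ^+ j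
       * ((u i).1.1 ^+ 2 + (u i).1.2 ^+ 2) ^+ j * (u i).2 ^+ (2 * (l - j))
       * (z ^+ (2 * (l - j)) * (1 - z ^+ 2) ^+ j).
have IG : integral01 (fun z => \sum_(i < n) G i z) (\sum_(i < n) even_moment (q i)).
  apply: integral01_sum => i; apply: integral01_sum => l; apply: integral01Z.
  exact: integral_slice_moment.
have Ic : integral01 (fun=> c) c.
  rewrite -[X in integral01 _ X]mulr1; apply: integral01_ext (integral01Z c _).
    by move=> x; rewrite -[RHS]mulr1 -(expr0 x).
  by have := integral01_expn R 0; rewrite invr1.
apply: integral01_le Ic IG => z z01.
have GE i : G i z = N%:R^-1 * \sum_(k < N) (q i).[dot3 (u i) (sphere_point N k z) ^+ 2].
  under eq_bigr do rewrite horner_coef.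
  rewrite exchange_big /= big_distrr /=; apply: eq_bigr => l _.
  have lN : (2 * l < N)%N by have := szN i; have := ltn_ord l; lia.
  rewrite -(slice_moment (u i) lN z01) mulrCA; congr (_ * _).
  by rewrite big_distrr /=; apply: eq_bigr => k _; rewrite exprM.
under eq_bigr do rewrite GE.
rewrite -big_distrr /= exchange_big /= ler_pdivlMl ?ltr0n // mulr_natl.
rewrite -[X in _ *+ X]card_ord -sumr_const; apply: ler_sum => k _.
by apply: cle; apply: sphere_point_unit.
Qed.

End SphereAverage.
(** * Sums of absolute values of linear forms *)

Section KinkGain.
Variable R : realType.

(* On a rotation by an angle with cosine C crossing no kink, [h = \sum b |p|]
   satisfies [h(+) + h(-) = 2 C h], so the lower bound r improves to r / C. *)
Lemma kink_gain (n : nat) (b p s : 'I_n -> R) (C S r : R) :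
  (forall i, 0 <= b i) -> 0 < C -> (forall i, `|S * s i| <= `|C * p i|) ->
  r <= \sum_(i < n) b i * `|C * p i + S * s i| ->
  r <= \sum_(i < n) b i * `|C * p i - S * s i| ->
  r / C <= \sum_(i < n) b i * `|p i|.
Proof.
move=> b0 C0 no_kink rD rB; rewrite ler_pdivrMr // -(ler_pM2l (ltr0Sn R 1)).
have -> : 2 * ((\sum_(i < n) b i * `|p i|) * C)
   = \sum_(i < n) b i * `|C * p i + S * s i| + \sum_(i < n) b i * `|C * p i - S * s i|.
  rewrite -big_split /= big_distrl big_distrr /=; apply: eq_bigr => i _.
  rewrite -mulrDr -mulrA mulrCA; congr (_ * _).
  have := no_kink i; rewrite [`|C * p i|]normrM (gtr0_norm C0) [`|p i| * C]mulrC.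
  have -> : C * `|p i| = `|C * p i| by rewrite normrM (gtr0_norm C0).
  move: (C * p i) (S * s i) => a c.
  by case: (ger0P a); case: (ger0P c); case: (ger0P (a + c)); case: (ger0P (a - c)); lra.
lra.
Qed.

Lemma bernoulli_le (x : R) m : 0 <= x <= 1 -> 1 - m%:R * x <= (1 - x) ^+ m.
Proof.
move=> x01; elim: m => [|m IHm]; first by rewrite mul0r subr0.
rewrite exprS -natr1.
apply: (@le_trans _ _ ((1 - x) * (1 - m%:R * x))); last by rewrite ler_wpM2l //; lra.
have := ler0n R m; nra.
Qed.

(** Removes the error 1 / (j + 2) left by the polynomial approximation of the absolute value. *)
Lemma le_forall_addV (x a : R) : (forall j : nat, x <= a + j.+2%:R^-1) -> x <= a.
Proof.
move=> xa; apply/ler_addgt0Pr => e e0.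
have /= ej := truncnS_gt (e^-1); set j := Num.truncn _ in ej.
apply: (le_trans (xa j)); rewrite lerD2l -[leRHS]invrK lef_pV2 ?posrE ?invr_gt0 ?ltr0n //.
by rewrite -natr1; lra.
Qed.

End KinkGain.

(** * The bound for all directions of the sphere *)

Section SphereBound.
Variable R : realType.
Implicit Types (t z : R) (u v y : R * R * R) (q : {poly R}).

Lemma integral01_uniq (f : R -> R) (c d : R) :
  integral01 f c -> integral01 f d -> c = d.
Proof.
move=> Ic Id; apply/eqP; rewrite eq_le.
by rewrite (integral01_le _ Ic Id) ?(integral01_le _ Id Ic).
Qed.

Lemma integral01_ge0 (f : R -> R) (c : R) : (forall x, 0 <= x <= 1 -> 0 <= f x) ->
  integral01 f c -> 0 <= c.
Proof.
move=> f0 If; apply: (@integral01_le R (fun=> 0) f) f0 _ If.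
exists (cst 0); split; last by rewrite /cst subrr.
by move=> x; apply: is_derive_cst.
Qed.

Lemma even_moment_comb (a c : R) (p q : {poly R}) :
  even_moment (a *: p + c *: q) = a * even_moment p + c * even_moment q.
Proof.
apply: integral01_uniq (integral_even_moment _) _.
apply: integral01_ext (integral01D (integral01Z a (integral_even_moment p))
   (integral01Z c (integral_even_moment q))) => t.
by rewrite hornerD !hornerZ.
Qed.

Lemma integral01_onem_expn n : integral01 (fun t => (1 - t) ^+ n) (n.+1%:R)^-1.
Proof.
exists ((- n.+1%:R^-1) *: ((cst 1 - id : R -> R) ^+ n.+1)); split.
  move=> x; apply: is_derive_eq.
  rewrite !fctE /GRing.scale /= sub0r; field.
  by rewrite nat1r pnatr_eq0.
by rewrite !fctE /GRing.scale /= subrr subr0 expr1n expr0n /=; ring.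
Qed.

(* Decreases to the square root on [0, 1]: at t^2 the error is multiplied at
   each step by 1 - (sqrt_approx + t) / 2 <= 1 - t. *)
Fixpoint sqrt_approx (j : nat) : {poly R} :=
  if j is j'.+1 then
    sqrt_approx j' - 2^-1 *: (sqrt_approx j' * sqrt_approx j' - 'X)
  else 1.

Lemma sqrt_approx_bounds j t : 0 <= t <= 1 ->
  t <= (sqrt_approx j).[t ^+ 2] <= t + (1 - t) ^+ j.+1.
Proof.
move=> t01; elim: j => [|j IHj] /=; first by rewrite hornerC expr1; apply/andP; split; lra.
have : (1 - t) ^+ j.+1 <= 1 - t.
  by rewrite exprS ler_piMr ?exprn_ile1 //; lra.
rewrite !hornerE [_ ^+ j.+2]exprS; move: IHj.
move: ((1 - t) ^+ j.+1) (_.[_]) => e a; move=> /andP[ta ae] e1.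
by apply/andP; split; nra.
Qed.

(** The 1/2 is the integral of t, that is, the mean of |u . y| on the sphere; the rest is the
    integral of the error bound (1 - t)^(j+1). *)
Lemma even_moment_sqrt_approx j : even_moment (sqrt_approx j) <= 1 / 2 + j.+2%:R^-1.
Proof.
have := integral01D (integral01_expn R 1) (integral01_onem_expn j.+1).
rewrite div1r; apply: integral01_le (integral_even_moment _) => t t01.
by rewrite expr1; have /andP[] := sqrt_approx_bounds j t01.
Qed.

Lemma even_moment_peak m : even_moment ((1 - 'X) ^+ m) = beta_moment R m 0.
Proof.
apply: integral01_uniq (integral_even_moment _) _.
apply: integral01_ext (integral01_beta R m 0) => t.
by rewrite muln0 expr0 mul1r horner_exp !hornerE.
Qed.

(** The Gram determinant of u, y, v is the square of their triple product d, and here it equals 1 -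
    (u . y)^2 - (u . v)^2. *)
Lemma bessel3 u y v : dot3 u u = 1 -> dot3 y y = 1 -> dot3 v v = 1 ->
  dot3 y v = 0 -> dot3 u y ^+ 2 + dot3 u v ^+ 2 <= 1.
Proof.
move=> uu yy vv yv.
pose d := u.1.1 * (y.1.2 * v.2 - y.2 * v.1.2) + u.1.2 * (y.2 * v.1.1 - y.1.1 * v.2)
  + u.2 * (y.1.1 * v.1.2 - y.1.2 * v.1.1).
have gram : d ^+ 2 = dot3 u u * (dot3 y y * dot3 v v - dot3 y v ^+ 2)
   - dot3 u y * (dot3 u y * dot3 v v - dot3 y v * dot3 u v)
   + dot3 u v * (dot3 u y * dot3 y v - dot3 y y * dot3 u v).
  by rewrite /d /dot3; ring.
move: gram; rewrite uu yy vv yv => gram.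
have := sqr_ge0 d; rewrite gram; lra.
Qed.

Lemma orthogonal_unit y : dot3 y y = 1 -> exists v, dot3 v v = 1 /\ dot3 y v = 0.
Proof.
move=> yy; have [y0|y0] := eqVneq (y.1.1 ^+ 2 + y.1.2 ^+ 2) 0.
  exists (1, 0, 0); split; first by rewrite /dot3 /=; ring.
  have : y.1.1 ^+ 2 = 0 by have := sqr_ge0 y.1.1; have := sqr_ge0 y.1.2; lra.
  by move/eqP; rewrite sqrf_eq0 /dot3 /= => /eqP ->; ring.
set s := Num.sqrt (y.1.1 ^+ 2 + y.1.2 ^+ 2).
have s2 : s ^+ 2 = y.1.1 ^+ 2 + y.1.2 ^+ 2.
  by rewrite sqr_sqrtr // addr_ge0 ?sqr_ge0.
have s0 : s != 0 by rewrite -sqrf_eq0 s2.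
exists (- y.1.2 / s, y.1.1 / s, 0); split; last by rewrite /dot3 /=; ring.
transitivity ((y.1.1 ^+ 2 + y.1.2 ^+ 2) / s ^+ 2); first by rewrite /dot3 /=; field.
by rewrite s2 divff.
Qed.

(** Rotate y towards an orthogonal v by the angles with cosine C and sines S and -S. By Bessel S^2
    (u . v)^2 <= S^2 (1 - (u . y)^2), which is at most C^2 (u . y)^2 as soon as S^2 <= (u . y)^2: no
    kink is crossed. *)
Lemma sphere_kink_gain (n : nat) (b : 'I_n -> R) (u : 'I_n -> R * R * R) (C S r : R) y :
  (forall i, 0 <= b i) -> (forall i, dot3 (u i) (u i) = 1) ->
  0 < C -> C ^+ 2 + S ^+ 2 = 1 ->
  (forall v, dot3 v v = 1 -> r <= \sum_(i < n) b i * `|dot3 (u i) v|) ->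
  dot3 y y = 1 -> (forall i, S ^+ 2 <= dot3 (u i) y ^+ 2) ->
  r / C <= \sum_(i < n) b i * `|dot3 (u i) y|.
Proof.
move=> b0 u1 C0 CS rle yy good; have [v [vv yv]] := orthogonal_unit yy.
pose y' (e : R) := (C * y.1.1 + e * S * v.1.1, C * y.1.2 + e * S * v.1.2, C * y.2 + e * S * v.2).
have y'1 e : e ^+ 2 = 1 -> dot3 (y' e) (y' e) = 1.
  move=> e1; transitivity (C ^+ 2 * dot3 y y + 2 * (C * S * e) * dot3 y v + e ^+ 2 * S ^+ 2 * dot3 v v).
    by rewrite /dot3 /=; ring.
  by rewrite yy yv vv e1 -[RHS]CS; ring.
have y'dot e w : dot3 w (y' e) = C * dot3 w y + e * S * dot3 w v.
  by rewrite /dot3 /=; ring.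
apply: (@kink_gain R n b (fun i => dot3 (u i) y) (fun i => dot3 (u i) v) C S) => //.
- move=> i; rewrite -ler_sqr ?nnegrE ?normr_ge0 // !real_normK ?num_real //.
  rewrite !exprMn; have := bessel3 (u1 i) yy vv yv; have := good i.
  have -> : S ^+ 2 = 1 - C ^+ 2 by rewrite -[1]CS; ring.
  have C1 : C ^+ 2 <= 1 by rewrite -[leRHS]CS lerDl sqr_ge0.
  by move: C1; move: (C ^+ 2) (dot3 (u i) y ^+ 2) (dot3 (u i) v ^+ 2) (sqr_ge0 C) => ? ? ? ?; nra.
- apply: (le_trans (rle _ (y'1 1 (expr1n _ _)))); apply: ler_sum => i _.
  by rewrite y'dot mul1r.
- have N1 : (-1) ^+ 2 = 1 :> R by rewrite sqrrN expr1n.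
  apply: (le_trans (rle _ (y'1 _ N1))); apply: ler_sum => i _.
  by rewrite y'dot mulN1r mulNr.
Qed.

(** The assumption says that the gain r / C - r is lost on at most half of the sphere. It gives r <=
    C / (1 + C), and (1 + C)^2 <= 4 does the rest. *)
Lemma kink_estimate (k : R) (C r : R) : 0 <= r -> 0 < C -> C <= 1 ->
  r / C <= 1 / 2 + r * (C^-1 - 1) * 2^-1 -> r <= 1 / 2 - (1 - C ^+ 2) / 8.
Proof.
move=> r0 C0 C1; rewrite -(ler_pM2r C0) => le.
have : r <= C / 2 + r * (1 - C) / 2.
  apply: le_trans (le_trans _ le) _; first by rewrite divfK ?gt_eqF.
  by rewrite le_eqVlt; apply/orP; left; apply/eqP; field; rewrite gt_eqF.
move=> le'; have : r * (1 + C) <= C by lra.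
have C1' : 0 < 1 + C by lra.
move=> h; rewrite -(ler_pM2r C1'); apply: le_trans h _.
have : 0 <= (1 - C) * (4 - (1 + C) ^+ 2) by apply: mulr_ge0; nra.
lra.
Qed.

Lemma sphere_bound (n : nat) (b : 'I_n -> R) (u : 'I_n -> R * R * R) (r : R) :
  (0 < n)%N -> (forall i, 0 <= b i) -> \sum_(i < n) b i <= 1 ->
  (forall i, dot3 (u i) (u i) = 1) ->
  (forall y, dot3 y y = 1 -> r <= \sum_(i < n) b i * `|dot3 (u i) y|) ->
  r <= 1 / 2 - 288^-1 / n%:R ^+ 2.
Proof.
move=> n0 b0 b1 u1 rle.
have n1 : 1 <= n%:R :> R by rewrite ler1n.
have nn : 0 < (n%:R^-1 : R) <= 1.
  by rewrite invr_gt0 invf_le1 ?(lt_le_trans ltr01 n1).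
have [r0|r0] := ltP r 0; first by rewrite -exprVn; nra.
(* The sine of the rotation angle is 1 / (6 n), so the gain (1 - C^2) / 8 = S^2 / 8 has constant 8 *
   36 = 288. *)
pose S : R := 6^-1 / n%:R; pose C := Num.sqrt (1 - S ^+ 2).
have S2 : S ^+ 2 = 36^-1 * n%:R^-1 ^+ 2 by rewrite /S exprMn; congr (_ * _); field.
have S01 : 0 <= S ^+ 2 <= 36^-1 by rewrite S2; nra.
have C2 : C ^+ 2 = 1 - S ^+ 2 by rewrite sqr_sqrtr //; lra.
have C0 : 0 < C by rewrite sqrtr_gt0; lra.
have C1 : C <= 1 by rewrite -ler_sqr ?nnegrE ?ler01 ?(ltW C0) // expr1n; lra.
have -> : 288^-1 / n%:R ^+ 2 = (1 - C ^+ 2) / 8 :> R.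
  by rewrite C2 S2 -exprVn; field; rewrite gt_eqF //; lra.
apply: kink_estimate => //; apply: le_forall_addV => j.
(* The polynomial (1 - X)^m / D majorizes the indicator of [0, S^2], and its
   mean over the sphere is at most 1 / (2 n). *)
pose m := (16 * n ^ 2).-1.
have mS : m.+1 = (16 * n ^ 2)%N by rewrite prednK // muln_gt0 expn_gt0 n0.
pose g := r * (C^-1 - 1).
have g0 : 0 <= g by rewrite mulr_ge0 // subr_ge0 -invr1 lef_pV2 ?posrE.
pose D := (1 - S ^+ 2) ^+ m.
(* By Bernoulli D >= 1 - m S^2, and m S^2 <= 16 / 36. With a peak of mean at most 1 / (4 n), the n
   peaks divided by D have total mean at most 1/2. *)
have D2 : 2^-1 <= D.
  apply: le_trans (bernoulli_le m _); last by lra.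
  have : m%:R <= 16 * n%:R ^+ 2 :> R by rewrite -natrX -natrM -mS ler_nat.
  rewrite S2; have : n%:R * n%:R^-1 = 1 :> R by rewrite divff // gt_eqF //; lra.
  move=> nV; have : n%:R ^+ 2 * n%:R^-1 ^+ 2 = 1 :> R by rewrite -exprMn nV expr1n.
  have : 0 <= n%:R^-1 ^+ 2 :> R by rewrite sqr_ge0.
  move: (n%:R^-1 ^+ 2) (n%:R ^+ 2) => a c; nra.
have D0 : 0 < D by lra.
have W4 : beta_moment R m 0 <= 4^-1 / n%:R.
  rewrite -ler_sqr ?nnegrE.
  - apply: le_trans (beta_moment_sqr R m) _.
    rewrite mS natrM natrX le_eqVlt; apply/orP; left; apply/eqP; field.
    by rewrite gt_eqF //; lra.
  - apply: integral01_ge0 (integral01_beta R m 0) => t t01.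
    by rewrite mulr_ge0 ?exprn_ge0 //; nra.
  - lra.
(* The first terms majorize h; the peaks add at least g = r / C - r wherever some kink is too close.
   Hence the sum is at least r / C on the whole sphere. *)
pose q i := b i *: sqrt_approx j + (g / D) *: (1 - 'X) ^+ m.
apply: (@le_trans _ _ (\sum_(i < n) even_moment (q i))).
  apply: (sphere_average (u := u)) => // y yy.
  have cs i : dot3 (u i) y ^+ 2 <= 1.
    have [v [vv yv]] := orthogonal_unit yy.
    by have := bessel3 (u1 i) yy vv yv; have := sqr_ge0 (dot3 (u i) v); lra.
  have absE i : `|dot3 (u i) y| <= (sqrt_approx j).[dot3 (u i) y ^+ 2].
    have t01 : 0 <= `|dot3 (u i) y| <= 1.
      by rewrite normr_ge0 -(@expr_le1 _ 2) ?normr_ge0 // real_normK ?num_real // cs.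
    have := sqrt_approx_bounds j t01; rewrite real_normK ?num_real //.
    by case/andP.
  have peak0 i : 0 <= g / D * (1 - dot3 (u i) y ^+ 2) ^+ m.
    by rewrite mulr_ge0 ?divr_ge0 ?(ltW D0) // exprn_ge0 // subr_ge0 cs.
  have qE i : (q i).[dot3 (u i) y ^+ 2] = b i * (sqrt_approx j).[dot3 (u i) y ^+ 2]
       + g / D * (1 - dot3 (u i) y ^+ 2) ^+ m.
    by rewrite /q hornerD !hornerZ horner_exp !hornerE.
  under eq_bigr do rewrite qE.
  rewrite big_split /=.
  have hle : \sum_(i < n) b i * `|dot3 (u i) y|
      <= \sum_(i < n) b i * (sqrt_approx j).[dot3 (u i) y ^+ 2].
    by apply: ler_sum => i _; rewrite ler_wpM2l.
  have [good|/existsP[i0 bad]] := boolP [forall i, S ^+ 2 <= dot3 (u i) y ^+ 2].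
    rewrite -[r / C]addr0; apply: lerD.
      apply: le_trans hle; apply: (sphere_kink_gain (S := S)) => //.
        by rewrite C2 subrK.
      by move=> i; exact: (forallP good).
    by apply: sumr_ge0.
  have -> : r / C = r + g by rewrite /g; ring.
  apply: lerD; first exact: le_trans (rle y yy) hle.
  rewrite (bigD1 i0) //=; apply: ler_wpDr; first by apply: sumr_ge0.
  rewrite -mulrA ler_peMr // ler_pdivlMl // mulr1.
  apply: lerXn2r; rewrite ?nnegrE; [lra|by rewrite subr_ge0|].
  by move: bad; rewrite -ltNge => /ltW; lra.
under eq_bigr do rewrite even_moment_comb even_moment_peak.
rewrite big_split /= -big_distrl sumr_const card_ord.
rewrite -addrA [r * _ * _ + _]addrC addrA; apply: lerD.
  have := even_moment_sqrt_approx j.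
  have : 0 <= even_moment (sqrt_approx j).
    apply: integral01_ge0 (integral_even_moment _) => t t01.
    by have /andP[] := sqrt_approx_bounds j t01; lra.
  move: (even_moment _) => M M0 M1; apply: le_trans M1.
  by rewrite ler_piMl.
rewrite -/g -mulrnAr -mulrA ler_wpM2l // -mulr_natl.
have nV : n%:R * n%:R^-1 = 1 :> R by rewrite divff // gt_eqF //; lra.
have : n%:R * beta_moment R m 0 <= 4^-1.
  by apply: le_trans (ler_wpM2l _ W4) _; rewrite // mulrCA nV mulr1.
rewrite ler_pdivrMl //; lra.
Qed.

End SphereBound.

(** * The bound for the directions of a plane *)

Section CircleBound.
Variable R : realType.
Implicit Types (t x : R) (u v y : R * R).

(** Starting from cos <= 1, each of the three Taylor bounds below yields the next by integration. *)
Lemma ge0_of_derivative_ge0 (f g : R -> R) x : (forall t, is_derive t 1 f (g t)) ->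
  (forall t, 0 <= t -> 0 <= g t) -> 0 <= f 0 -> 0 <= x -> 0 <= f x.
Proof.
move=> df g0 f0 x0.
have fc : {within `[0, x], continuous f}%classic.
  by apply: derivable_within_continuous => t _; case: (df t).
have [c] := MVT_segment x0 (fun t _ => df t) fc.
rewrite in_itv subr0 /= => /andP[/g0 gc _] fE.
have : 0 <= g c * x by apply: mulr_ge0.
lra.
Qed.

Lemma sin_le_id x : 0 <= x -> sin x <= x.
Proof.
move=> x0; rewrite -subr_ge0.
apply: (@ge0_of_derivative_ge0 (id - sin) (fun t => 1 - cos t) x _ _ _ x0).
- by move=> t _; rewrite subr_ge0 cos_le1.
- by rewrite -[(id - sin) 0]/(0 - sin 0) sin0 subrr.
Qed.

Lemma cos_ge_quadratic x : 0 <= x -> 1 - x ^+ 2 / 2 <= cos x.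
Proof.
move=> x0; rewrite -subr_ge0.
pose f : R -> R := cos - (cst 1 - 2^-1 *: (id : R -> R) ^+ 2).
have fE t : f t = cos t - (1 - t ^+ 2 / 2) by rewrite /f !fctE /GRing.scale /=; ring.
rewrite -fE; apply: (@ge0_of_derivative_ge0 f (fun t => t - sin t) x _ _ _ x0).
- by move=> t; apply: is_derive_eq; rewrite /GRing.scale /=; field.
- by move=> t t0; rewrite subr_ge0 sin_le_id.
- by rewrite fE cos0; lra.
Qed.

Lemma sin_ge_cubic x : 0 <= x -> x - x ^+ 3 / 6 <= sin x.
Proof.
move=> x0; rewrite -subr_ge0.
pose f : R -> R := sin - (id - 6^-1 *: (id : R -> R) ^+ 3).
have fE t : f t = sin t - (t - t ^+ 3 / 6) by rewrite /f !fctE /GRing.scale /=; ring.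
rewrite -fE; apply: (@ge0_of_derivative_ge0 f (fun t => cos t - (1 - t ^+ 2 / 2)) x _ _ _ x0).
- by move=> t; apply: is_derive_eq; rewrite /GRing.scale /=; field.
- by move=> t t0; rewrite subr_ge0 cos_ge_quadratic.
- by rewrite fE sin0; lra.
Qed.

(** Half the spacing of N equidistant directions on a half circle, which suffices because |cos| has
    period pi. *)
Definition half_step (N : nat) : R := pi / (2 * N%:R).

Lemma half_step_N N : (0 < N)%N -> half_step N * 2 * N%:R = pi.
Proof.
move=> N0; rewrite /half_step; field.
by rewrite pnatr_eq0 -lt0n.
Qed.

Lemma half_step_gt0 N : (0 < N)%N -> 0 < half_step N.
Proof. by move=> N0; rewrite divr_gt0 ?pi_gt0 ?mulr_gt0 ?ltr0n. Qed.

Definition cos_sum N t := \sum_(k < N) `|cos (t + half_step N * 2 * k%:R)|.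

(** A shift by one step permutes the samples cyclically: the one that leaves returns shifted by
    pi. *)
Lemma cos_sum_shift N t m : (0 < N)%N ->
  cos_sum N (t + half_step N * 2 * m%:R) = cos_sum N t.
Proof.
move=> N0; elim: m => [|m IHm]; first by rewrite mulr0 addr0.
rewrite -{}IHm /cos_sum; set s := t + _ * m%:R.
have sE k : t + half_step N * 2 * m.+1%:R + half_step N * 2 * k%:R
    = s + half_step N * 2 * k.+1%:R.
  by rewrite /s -natr1 -[k.+1%:R]natr1; ring.
under eq_bigr do rewrite sE.
case: N N0 @s {sE} => // N _ s.
rewrite big_ord_recr /= half_step_N // cosDpi normrN addrC big_ord_recl /=.
by rewrite mulr0 addr0.
Qed.

(** Whole steps are removed until all samples lie in [- pi / 2, pi / 2], where cos is nonnegative.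
    Multiplied by sin h, with h the half step, the sum then telescopes to - sin (s - h) <= 1. *)
Lemma cos_sum_le N t : (0 < N)%N -> - (pi / 2) <= t -> cos_sum N t <= (sin (half_step N))^-1.
Proof.
move=> N0 t0; have piN := half_step_N N0; have h0 := half_step_gt0 N0.
have N1 : 1 <= N%:R :> R by rewrite ler1n.
set h := half_step N in piN h0 *.
pose a := (t + pi / 2) / (h * 2); have a0 : 0 <= a by rewrite divr_ge0 //; lra.
pose m := Num.truncn a.
have /andP[ma am] : m%:R <= a < m.+1%:R by rewrite truncn_itv.
have aE : t + pi / 2 = h * 2 * a.
  by rewrite /a; field; rewrite gt_eqF.
pose s := t - h * 2 * m%:R.
have sl : - (pi / 2) <= s by rewrite /s; nra.
have sr : s <= - (pi / 2) + h * 2.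
  by move: am; rewrite -natr1 /s => am; nra.
have -> : cos_sum N t = cos_sum N s.
  by rewrite -(cos_sum_shift s m N0) -/h /s subrK.
have sinh : 0 < sin h.
  apply: sin_gt0_pi; have pi0 := pi_gt0 R; rewrite h0 /=.
  by have := ler_wpM2l (ltW h0) N1; lra.
rewrite -[leRHS]mul1r ler_pdivlMr //.
(* From 2 cos a sin h = sin (a + h) - sin (a - h). *)
pose f k := 2^-1 * sin (s - h + h * 2 * k%:R).
have -> : cos_sum N s * sin h = \sum_(0 <= k < N) (f k.+1 - f k).
  rewrite /cos_sum -/h big_distrl big_mkord /=; apply: eq_bigr => k _.
  rewrite ger0_norm; last first.
    apply: cos_ge0_pihalf; apply/andP; split.
      have : 0 <= h * 2 * k%:R by apply: mulr_ge0; rewrite ?ler0n //; lra.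
      lra.
    have : h * 2 * k.+1%:R <= h * 2 * N%:R by apply: ler_wpM2l; rewrite ?ler_nat //; lra.
    rewrite piN -[k.+1%:R]natr1; lra.
  rewrite /f -[k.+1%:R]natr1.
  have -> : s - h + h * 2 * (k%:R + 1) = (s + h * 2 * k%:R) + h by ring.
  have -> : s - h + h * 2 * k%:R = (s + h * 2 * k%:R) - h by ring.
  by rewrite sinD sinB; field.
rewrite telescope_sumr //= /f piN mulr0 addr0 sinDpi.
have := sin_geN1 (s - h); lra.
Qed.

(** Distinct samples a, c differ by an angle between 2 h and pi - 2 h, with h the half step. So |cos
    a| + |cos c| >= sin (c - a) >= sin (2 h) = 2 sin h cos h, and the two cannot both be below half
    of this. *)
Lemma few_small_cos N t (k l : 'I_N) : (0 < N)%N ->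
  `|cos (t + half_step N * 2 * k%:R)| < sin (half_step N) * cos (half_step N) ->
  `|cos (t + half_step N * 2 * l%:R)| < sin (half_step N) * cos (half_step N) ->
  k = l.
Proof.
move=> N0; have piN := half_step_N N0; have h0 := half_step_gt0 N0.
have pi0 := pi_gt0 R; set h := half_step N in piN h0 *.
wlog kl : k l / (k <= l)%N.
  move=> W; have [kl|/ltnW lk] := leqP k l; first exact: W.
  by move=> *; symmetry; apply: W.
move=> ck cl; apply: val_inj; apply/eqP; move: kl; rewrite leq_eqVlt => /orP[//|kl].
exfalso; set a := t + h * 2 * k%:R in ck; set c := t + h * 2 * l%:R in cl.
have kl1 : 1 <= l%:R - k%:R :> R.
  by rewrite lerBrDr nat1r ler_nat.
have klN : l%:R - k%:R <= N%:R - 1 :> R.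
  rewrite lerBlDr addrAC lerBrDr natr1 -natrD ler_nat; have := ltn_ord l; lia.
have caE : c - a = h * 2 * (l%:R - k%:R) by rewrite /a /c; ring.
have ca1 : h * 2 <= c - a by rewrite caE; nra.
have ca2 : c - a <= pi - h * 2 by rewrite caE; nra.
have : sin (c - a) <= `|cos a| + `|cos c|.
  rewrite sinB; apply: (le_trans (ler_norm _)); apply: (le_trans (ler_normB _ _)).
  rewrite !normrM; apply: lerD; first by rewrite ler_piMl ?sin_max.
  by rewrite ler_piMr ?sin_max.
suff : sin (h * 2) <= sin (c - a).
  by rewrite mulr_natr sin_mulr2n; lra.
have mono p q : 0 <= p -> p <= q -> q <= pi / 2 -> sin p <= sin q.
  move=> p0; rewrite le_eqVlt => /orP[/eqP -> //|pq] q2; apply: ltW.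
  by rewrite ltr_sin // in_itv /=; apply/andP; split; lra.
have [ca|ca] := leP (c - a) (pi / 2); first by apply: mono => //; lra.
have -> : sin (c - a) = sin (pi - (c - a)).
  by rewrite [pi - _]addrC sinDpi sinN opprK.
by apply: mono; lra.
Qed.

Definition dot2 u v : R := u.1 * v.1 + u.2 * v.2.
Definition circle_point t : R * R := (cos t, sin t).

Lemma unit_angle u : dot2 u u = 1 ->
  exists t, - (pi / 2) <= t /\ forall s, `|dot2 u (circle_point s)| = `|cos (t + s)|.
Proof.
move=> u1; wlog u0 : u u1 / 0 <= u.1.
  move=> W; have [|/ltW u0] := leP 0 u.1; first exact: W.
  have [||t [t0 tE]] := W (- u.1, - u.2); first by rewrite -u1 /dot2 /=; ring.
    by rewrite oppr_ge0.
  exists t; split=> // s; rewrite -tE -normrN; congr `|_|.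
  by rewrite /dot2 /=; ring.
have u2 : - 1 <= - u.2 <= 1.
  by move: u1; rewrite /dot2 => u1; apply/andP; split; nra.
(* The sign makes u . (cos s, sin s) equal to cos (t + s); the lower bound on t is the one
   [cos_sum_le] asks for. *)
exists (asin (- u.2)); split; first exact: asin_geNpi2.
move=> s; rewrite cosD cos_asin // asinK ?in_itv //.
have -> : 1 - (- u.2) ^+ 2 = u.1 ^+ 2 by rewrite -u1 /dot2; ring.
by rewrite sqrtr_sqr (ger0_norm u0) mulNr opprK.
Qed.

Lemma circle_kink_gain (n : nat) (b : 'I_n -> R) (u : 'I_n -> R * R) (C S r : R) t :
  (forall i, 0 <= b i) -> (forall i, dot2 (u i) (u i) = 1) ->
  0 < C -> C ^+ 2 + S ^+ 2 = 1 ->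
  (forall y, dot2 y y = 1 -> r <= \sum_(i < n) b i * `|dot2 (u i) y|) ->
  (forall i, S ^+ 2 <= dot2 (u i) (circle_point t) ^+ 2) ->
  r / C <= \sum_(i < n) b i * `|dot2 (u i) (circle_point t)|.
Proof.
move=> b0 u1 C0 CS rle good; have cs := cos2Dsin2 t.
pose y' (e : R) := (C * cos t - e * S * sin t, C * sin t + e * S * cos t).
have y'1 e : e ^+ 2 = 1 -> dot2 (y' e) (y' e) = 1.
  move=> e1; transitivity ((C ^+ 2 + e ^+ 2 * S ^+ 2) * (cos t ^+ 2 + sin t ^+ 2)).
    by rewrite /dot2 /=; ring.
  by rewrite e1 mul1r CS cs mulr1.
pose v : R * R := (- sin t, cos t).
have y'dot e w : dot2 w (y' e) = C * dot2 w (circle_point t) + e * S * dot2 w v.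
  by rewrite /dot2 /=; ring.
apply: (@kink_gain R n b (fun i => dot2 (u i) (circle_point t)) (fun i => dot2 (u i) v) C S) => //.
- move=> i; rewrite -ler_sqr ?nnegrE ?normr_ge0 // !real_normK ?num_real //.
  rewrite !exprMn.
  have : dot2 (u i) (circle_point t) ^+ 2 + dot2 (u i) v ^+ 2 = 1.
    transitivity (dot2 (u i) (u i) * (cos t ^+ 2 + sin t ^+ 2)); last by rewrite u1 cs mulr1.
    by rewrite /dot2 /=; ring.
  have := good i; have -> : C ^+ 2 = 1 - S ^+ 2 by rewrite -[1]CS; ring.
  by move: (_ ^+ 2) (dot2 (u i) v ^+ 2) => a c; nra.
- apply: (le_trans (rle _ (y'1 1 (expr1n _ _)))); apply: ler_sum => i _.
  by rewrite y'dot mul1r.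
- have N1 : (-1) ^+ 2 = 1 :> R by rewrite sqrrN expr1n.
  apply: (le_trans (rle _ (y'1 _ N1))); apply: ler_sum => i _.
  by rewrite y'dot mulN1r mulNr.
Qed.

(** Seven samples in eight gain the factor 1 / C >= 1 + 11/24 x^2, so the left side is at least r (1
    + 2/5 x^2). Sampling costs only x / sin x <= 1 / (1 - x^2 / 6), and 2/5 > 1/6 leaves a net
    factor 1 + x^2 / 5. *)
Lemma circle_kink_estimate (x C r : R) : 0 <= r -> 0 < x -> x <= 1 / 4 -> 0 < C ->
  C ^+ 2 = 1 - (sin x * cos x) ^+ 2 ->
  r * (7 / C + 1) / 8 <= 2 / pi * (x / sin x) -> r <= 2 / pi * (1 - x ^+ 2 / 10).
Proof.
move=> r0 x0 x4 C0 C2 le.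
have X0 : 0 < x ^+ 2 by rewrite exprn_gt0.
have X1 : x ^+ 2 <= 16^-1 by nra.
have sinx := sin_ge_cubic (ltW x0); have cosx := cos_ge_quadratic (ltW x0).
have p0 : 0 < 2 / pi :> R by rewrite divr_gt0 ?pi_gt0.
move: (2 / pi) p0 le => p p0 le.
have sin_gt : x * (1 - x ^+ 2 / 6) <= sin x.
  by apply: le_trans sinx; rewrite le_eqVlt; apply/orP; left; apply/eqP; ring.
have sin0 : 0 < sin x by apply: lt_le_trans sin_gt; apply: mulr_gt0; lra.
have SC : x * (1 - 2 / 3 * x ^+ 2) <= sin x * cos x.
  apply: (@le_trans _ _ (x * (1 - x ^+ 2 / 6) * (1 - x ^+ 2 / 2))).
    rewrite -[leRHS]mulrA ler_pM2l //; have := sqr_ge0 (x ^+ 2).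
    by move: (x ^+ 2) => X; lra.
  by apply: ler_pM; rewrite ?mulr_ge0 //; lra.
have S2 : 11 / 12 * x ^+ 2 <= (sin x * cos x) ^+ 2.
  apply: (@le_trans _ _ ((x * (1 - 2 / 3 * x ^+ 2)) ^+ 2)).
    rewrite exprMn [leLHS]mulrC ler_pM2l //; move: X0 X1; move: (x ^+ 2) => X; nra.
  have l0 : 0 <= x * (1 - 2 / 3 * x ^+ 2) by apply: mulr_ge0; lra.
  by rewrite lerXn2r ?nnegrE // (le_trans l0).
have CV : 1 + 11 / 24 * x ^+ 2 <= C^-1.
  rewrite -[leRHS]div1r ler_pdivlMr // -(@expr_le1 _ 2) //; last by apply: mulr_ge0; lra.
  rewrite exprMn C2; move: X0 X1 S2; move: (x ^+ 2) ((sin x * cos x) ^+ 2) => X Y X0 X1 XY.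
  have : (1 + 11 / 24 * X) ^+ 2 * (1 - Y) <= (1 + 11 / 24 * X) ^+ 2 * (1 - 11 / 12 * X).
    by rewrite ler_wpM2l ?sqr_ge0 //; lra.
  have : 0 <= X ^+ 3 by rewrite exprn_ge0 // ltW.
  by move=> X3 /le_trans; apply; have := sqr_ge0 X; lra.
have xs : x / sin x * (1 - x ^+ 2 / 6) <= 1.
  by rewrite mulrAC ler_pdivrMr // mul1r.
have : r * (1 + 2 / 5 * x ^+ 2) <= p * (x / sin x).
  apply: le_trans le; rewrite -[leRHS]mulrA ler_wpM2l //.
  by move: X0 CV; move: (x ^+ 2) (C^-1) => X Y *; lra.
have E6 : 0 < 1 - x ^+ 2 / 6 by lra.
rewrite -(ler_pM2r E6) -[leRHS]mulrA => h.
have : r * (1 + 2 / 5 * x ^+ 2) * (1 - x ^+ 2 / 6) <= p.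
  by apply: le_trans h _; rewrite ler_piMr // ltW.
have : r * (1 + x ^+ 2 / 5) <= r * (1 + 2 / 5 * x ^+ 2) * (1 - x ^+ 2 / 6).
  by rewrite -[leRHS]mulrA ler_wpM2l //; move: X0 X1; move: (x ^+ 2) => X; nra.
move=> /le_trans H /H {H}h.
have E5 : 0 < 1 + x ^+ 2 / 5 by lra.
rewrite -(ler_pM2r E5); apply: le_trans h _; rewrite -[leRHS]mulrA ler_peMr ?(ltW p0) //.
by move: X0 X1; move: (x ^+ 2) => X; nra.
Qed.

(* Sampling h at 8 n equally spaced directions: each of the n kinks spoils at
   most one of them, and the mean of |cos| over the samples exceeds 2 / pi by
   less than the gain. *)
Lemma circle_bound (n : nat) (b : 'I_n -> R) (u : 'I_n -> R * R) (r : R) :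
  (0 < n)%N -> (forall i, 0 <= b i) -> \sum_(i < n) b i <= 1 ->
  (forall i, dot2 (u i) (u i) = 1) ->
  (forall y, dot2 y y = 1 -> r <= \sum_(i < n) b i * `|dot2 (u i) y|) ->
  r <= 2 / pi - 640^-1 / n%:R ^+ 2.
Proof.
move=> n0 b0 b1 u1 rle.
have n1 : 1 <= n%:R :> R by rewrite ler1n.
have nn : n%:R != 0 :> R by rewrite gt_eqF //; lra.
have N0 : (0 < 8 * n)%N by rewrite muln_gt0.
have pi2 := pi_ge2 R; have pi4 : pi <= 4 :> R by have := pihalf_lt2 R; lra.
pose x := half_step (8 * n); have x0 : 0 < x := half_step_gt0 N0.
have xE : x * 16 * n%:R = pi by rewrite -(half_step_N N0) -/x natrM; ring.
have x4 : x <= 1 / 4 by nra.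
suff : 0 <= r -> r <= 2 / pi * (1 - x ^+ 2 / 10).
  have -> : x = pi / (16 * n%:R) by rewrite -xE; field.
  (* The constant 640 comes from pi / 1280 >= 2 / 1280. *)
  have -> : 2 / pi * (1 - (pi / (16 * n%:R)) ^+ 2 / 10) = 2 / pi - (pi / 1280) / n%:R ^+ 2 :> R.
    have pn : pi != 0 :> R by rewrite gt_eqF // pi_gt0.
    by move: (@pi R) pn => p p0; field; rewrite nn.
  have nV : 0 < (n%:R ^+ 2)^-1 :> R by rewrite invr_gt0 exprn_gt0 //; lra.
  have nV1 : (n%:R ^+ 2)^-1 <= 1 :> R by rewrite invf_le1 ?exprn_gt0 //; nra.
  have p2 : 2^-1 <= 2 / pi :> R by rewrite ler_pdivlMr ?pi_gt0 //; lra.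
  by have [r0|r0 _] := leP 0 r; [move=> /(_ isT)|]; nra.
move=> r0; pose S := sin x * cos x; pose C := Num.sqrt (1 - S ^+ 2).
have sin0 : 0 < sin x by apply: sin_gt0_pi; rewrite x0; lra.
have cos0 : 0 < cos x by apply: cos_gt0_pihalf; apply/andP; split; lra.
have S0 : 0 < S by rewrite mulr_gt0.
have S1 : S <= 1 / 4.
  apply: le_trans x4; apply: le_trans (sin_le_id (ltW x0)).
  by rewrite /S ler_piMr ?cos_le1 // ltW.
have C2 : C ^+ 2 = 1 - S ^+ 2 by rewrite sqr_sqrtr //; nra.
have C0 : 0 < C by rewrite sqrtr_gt0; nra.
have C1 : C <= 1 by rewrite -(@expr_le1 _ 2) ?(ltW C0) // C2; nra.
apply: (circle_kink_estimate r0 x0 x4 C0 C2).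
pose g := r / C - r.
have g0 : 0 <= g by rewrite subr_ge0 ler_peMr // -invr1 lef_pV2 ?posrE.
pose y (k : 'I_(8 * n)) := circle_point (x * 2 * k%:R).
pose bad i k := dot2 (u i) (y k) ^+ 2 < S ^+ 2.
(* At a spoiled sample the count is at least 1, and the left side drops to r or less. *)
have hle k : r / C - g * \sum_(i < n) (bad i k)%:R <= \sum_(i < n) b i * `|dot2 (u i) (y k)|.
  have [/existsP[i0 bad0]|/existsPn good] := boolP [exists i, bad i k].
    have yy : dot2 (y k) (y k) = 1 by rewrite /dot2 -!expr2 cos2Dsin2.
    apply: le_trans (rle _ yy); rewrite lerBlDr -lerBlDl -/g ler_peMr //.
    by rewrite (bigD1 i0) //= bad0 lerDl sumr_ge0.
  rewrite big1 ?mulr0 ?subr0; last by move=> i _; rewrite (negbTE (good i)).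
  apply: (circle_kink_gain (S := S)) => //; first by rewrite C2 subrK.
  by move=> i; rewrite leNgt good.
have badle i : \sum_(k < 8 * n) (bad i k)%:R <= 1 :> R.
  have [t [_ tE]] := unit_angle (u1 i).
  have badE k : bad i k -> `|cos (t + x * 2 * k%:R)| < S.
    move=> bik; rewrite -tE -ltr_sqr ?nnegrE ?normr_ge0 ?(ltW S0) //.
    by rewrite real_normK ?num_real.
  rewrite -natr_sum (ler_nat _ _ 1).
  have -> : (\sum_(k < 8 * n) bad i k = #|[pred k | bad i k]|)%N.
    by rewrite -sum1_card [RHS]big_mkcond; apply: eq_bigr => k _; rewrite inE; case: (bad i k).
  by apply/card_le1_eqP => k l; rewrite !inE => /badE ck /badE cl; exact: (few_small_cos N0 cl ck).
have sumle i : \sum_(k < 8 * n) `|dot2 (u i) (y k)| <= (sin x)^-1.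
  have [t [t0 tE]] := unit_angle (u1 i).
  by under eq_bigr do rewrite tE; exact: cos_sum_le.
have : \sum_(k < 8 * n) (r / C - g * \sum_(i < n) (bad i k)%:R) <= (sin x)^-1.
  apply: le_trans (ler_sum _ (fun k _ => hle k)) _.
  rewrite exchange_big /=; apply: (@le_trans _ _ (\sum_(i < n) b i * (sin x)^-1)).
    by apply: ler_sum => i _; rewrite -big_distrr /= ler_wpM2l.
  by rewrite -big_distrl /= ler_piMl // invr_ge0 ltW.
rewrite big_split /= sumr_const card_ord sumrN -big_distrr /= exchange_big /=.
have : \sum_(i < n) \sum_(k < 8 * n) (bad i k)%:R <= n%:R :> R.
  by apply: le_trans (ler_sum _ (fun i _ => badle i)) _; rewrite sumr_const card_ord.
move: (\sum_(i < n) _) => B Bn.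
rewrite -[_ *+ _]mulr_natr natrM => le.
(* At most n of the 8 n samples lose the gain g: 8 n r / C - n g = n r (7 / C + 1). *)
have le' : n%:R * (r * (7 / C + 1)) <= (sin x)^-1.
  apply: le_trans le; rewrite -subr_ge0.
  have -> : r / C * (8 * n%:R) - g * B - n%:R * (r * (7 / C + 1)) = g * (n%:R - B).
    by rewrite /g; ring.
  by rewrite mulr_ge0 // subr_ge0.
have -> : 2 / pi * (x / sin x) = (sin x)^-1 / n%:R / 8.
  by rewrite -xE; field; rewrite nn !gt_eqF.
by rewrite ler_pM2r // ler_pdivlMr ?(lt_le_trans ltr01) // mulrC.
Qed.

End CircleBound.
(** * From POVMs to Bloch vectors *)

Section BlochVectors.
Variable R : realType.
Local Open Scope complex_scope.
Local Notation C := R[i].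
Implicit Types (M : 'M[C]_2).

(** With [bloch_vector], the real coordinates of a Hermitian M = t 1 + w . sigma, extended
    real-linearly to all matrices. In the form alpha (1 + v . sigma), t is alpha and w is alpha
    v. *)
Definition bloch_trace M : R := (complex.Re (M 0 0) + complex.Re (M 1 1)) / 2.
Definition bloch_vector M : R * R * R :=
  ((complex.Re (M 0 1) + complex.Re (M 1 0)) / 2, (complex.Im (M 1 0) - complex.Im (M 0 1)) / 2,
   (complex.Re (M 0 0) - complex.Re (M 1 1)) / 2).

Lemma Re_sum_scale n (p : 'I_n -> R) (Pi : 'I_n -> 'M[C]_2) j k :
  complex.Re ((\sum_(i < n) (p i)%:C *: Pi i) j k) = \sum_(i < n) p i * complex.Re (Pi i j k).
Proof.
rewrite summxE (@big_morph _ _ (@complex.Re R) 0 +%R 0 +%R) //; last by move=> [a b] [c d].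
by apply: eq_bigr => i _; rewrite mxE; case: (Pi i j k) => a b /=; ring.
Qed.

Lemma Im_sum_scale n (p : 'I_n -> R) (Pi : 'I_n -> 'M[C]_2) j k :
  complex.Im ((\sum_(i < n) (p i)%:C *: Pi i) j k) = \sum_(i < n) p i * complex.Im (Pi i j k).
Proof.
rewrite summxE (@big_morph _ _ (@complex.Im R) 0 +%R 0 +%R) //; last by move=> [a b] [c d].
by apply: eq_bigr => i _; rewrite mxE; case: (Pi i j k) => a b /=; ring.
Qed.

Lemma bloch_trace_sum n (p : 'I_n -> R) (Pi : 'I_n -> 'M[C]_2) :
  bloch_trace (\sum_(i < n) (p i)%:C *: Pi i) = \sum_(i < n) p i * bloch_trace (Pi i).
Proof.
rewrite /bloch_trace !Re_sum_scale -big_split /= big_distrl /=.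
by apply: eq_bigr => i _; ring.
Qed.

Lemma bloch_vector_sum n (p : 'I_n -> R) (Pi : 'I_n -> 'M[C]_2) y :
  dot3 (bloch_vector (\sum_(i < n) (p i)%:C *: Pi i)) y
    = \sum_(i < n) p i * dot3 (bloch_vector (Pi i)) y.
Proof.
rewrite /dot3 /bloch_vector /= !Re_sum_scale !Im_sum_scale.
rewrite -!sumrB -!big_split /= !big_distrl -!big_split /=.
by apply: eq_bigr => i _; ring.
Qed.

Lemma psd_quadratic M (x y z : R) : psd M ->
  0 <= x ^+ 2 * complex.Re (M 0 0) + (y ^+ 2 + z ^+ 2) * complex.Re (M 1 1)
     + 2 * x * (y * (bloch_vector M).1.1 + z * (bloch_vector M).1.2).
Proof.
pose v : 'cV[C]_2 := \col_(i < 2) if i == 0 then x%:C else Complex y z.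
move=> /(_ v); rewrite lecE => /andP[_]; congr (_ <= _).
rewrite !mxE !big_ord_recl !big_ord0 !mxE !big_ord_recl !big_ord0 !mxE /=.
have -> : lift ord0 ord0 = 1 :> 'I_2 by apply: val_inj.
rewrite -[ord0]/(0 : 'I_2).
case: (M 0 0) (M 0 1) (M 1 0) (M 1 1) => [a a'] [b b'] [c c'] [d d'] /=.
by field.
Qed.

Lemma psd_bloch M : psd M ->
  0 <= bloch_trace M /\ dot3 (bloch_vector M) (bloch_vector M) <= bloch_trace M ^+ 2.
Proof.
move=> psdM; have Q x y z := psd_quadratic x y z psdM; move: Q.
rewrite /bloch_trace /dot3; set w := bloch_vector M.
have -> : w.2 = (complex.Re (M 0 0) - complex.Re (M 1 1)) / 2 by [].
move: (complex.Re (M 0 0)) (complex.Re (M 1 1)) w.1.1 w.1.2 => a d b c Q.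
have a0 : 0 <= a by have := Q 1 0 0; nra.
have d0 : 0 <= d by have := Q 0 1 0; nra.
split; first lra.
have bc : b ^+ 2 + c ^+ 2 <= a * d.
  (* The vector (d, - b - i c) gives d (a d - b^2 - c^2) >= 0. If d = 0, the vector (e, - (a + 1) (b
     + i c)) with e = b^2 + c^2 gives - e^2 (a + 2) >= 0, hence e = 0. *)
  have [dp|] := ltP 0 d.
    by rewrite -(ler_pM2l dp); have := Q d (- b) (- c); nra.
  move=> d00; have dE : d = 0 by lra.
  rewrite leNgt; apply/negP => abs; rewrite {}dE mulr0 in Q abs *.
  have := Q (b ^+ 2 + c ^+ 2) (- b * (a + 1)) (- c * (a + 1)).
  have : 0 < (b ^+ 2 + c ^+ 2) ^+ 2 * (a + 2) by rewrite mulr_gt0 ?exprn_gt0 //; lra.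
  lra.
nra.
Qed.

Lemma bloch_Pr_elem (r nx ny nz : R) b y :
  dot3 (bloch_vector (Pr_elem r nx ny nz b)) y
    = (if b then 1 else -1) * (r / 2) * dot3 (nx, ny, nz) y.
Proof.
have half : 2^-1 = (2^-1 : R)%:C by rewrite fmorphV rmorph_nat.
rewrite /dot3 /bloch_vector /Pr_elem /ndotsigma half !mxE /=.
by case: b => /=; field.
Qed.

Lemma povm_bloch n (Pi : 'I_n -> 'M[C]_2) : qubit_povm Pi ->
  [/\ forall i, 0 <= bloch_trace (Pi i),
      forall i, dot3 (bloch_vector (Pi i)) (bloch_vector (Pi i)) <= bloch_trace (Pi i) ^+ 2
    & \sum_(i < n) bloch_trace (Pi i) = 1].
Proof.
move=> [psdPi sumPi]; split; [by move=> i; have [] := psd_bloch (psdPi i)|by move=> i; have [] := psd_bloch (psdPi i)|].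
have := @bloch_trace_sum n (fun=> 1) Pi.
under eq_bigr do rewrite scale1r.
under [in RHS]eq_bigr do rewrite mul1r.
by move=> <-; rewrite sumPi /bloch_trace !mxE /=; field.
Qed.

Lemma povm_size_gt0 n (Pi : 'I_n -> 'M[C]_2) : qubit_povm Pi -> (0 < n)%N.
Proof.
case: n Pi => // Pi /povm_bloch[_ _]; rewrite big_ord0 => /esym/eqP.
by rewrite oner_eq0.
Qed.

(** Subtracting the two outcomes writes r as a combination of the Bloch components with weights
    p(true) - p(false) in [-1, 1]. *)
Lemma simulation_bound (X : Type) n (Pi : 'I_n -> 'M[C]_2) (M : X -> bool -> 'M[C]_2)
  x r (y : R * R * R) : simulates Pi M ->
  (forall b, dot3 (bloch_vector (M x b)) y = (if b then 1 else -1) * (r / 2)) ->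
  r <= \sum_(i < n) `|dot3 (bloch_vector (Pi i)) y|.
Proof.
move=> [p [p0 [p1 Mp]]] Mxy.
have rE : r = \sum_(i < n) (p x true i - p x false i) * dot3 (bloch_vector (Pi i)) y.
  under eq_bigr do rewrite mulrBl.
  by rewrite sumrB -!bloch_vector_sum -!Mp !Mxy; field.
rewrite {1}rE; apply: ler_sum => i _; apply: le_trans (ler_norm _) _.
rewrite normrM ler_piMl //; have := p1 x i; rewrite big_bool /= => p1i.
by have := p0 x true i; have := p0 x false i; rewrite ler_norml => *; apply/andP; split; lra.
Qed.

Lemma simulable_sphere_bound n (r : R) : simulable n r -> r <= 1 / 2 - 288^-1 / n%:R ^+ 2.
Proof.
move=> [Pi [povm sim]]; have n0 := povm_size_gt0 povm.
have [t0 wt t1] := povm_bloch povm.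
pose w i := bloch_vector (Pi i); pose b i := Num.sqrt (dot3 (w i) (w i)).
have ww0 (v : R * R * R) : 0 <= dot3 v v by rewrite /dot3 -!expr2 !addr_ge0 ?sqr_ge0.
(* A vanishing Bloch vector gets an arbitrary unit direction, with weight 0. *)
pose u i : R * R * R := if b i == 0 then (1, 0, 0)
  else ((w i).1.1 / b i, (w i).1.2 / b i, (w i).2 / b i).
have b2 i : b i ^+ 2 = dot3 (w i) (w i) by rewrite sqr_sqrtr ?ww0.
have wu i y : dot3 (w i) y = b i * dot3 (u i) y.
  rewrite /u; have [bi0|bi0] := eqVneq (b i) 0; last by rewrite /dot3 /=; field.
  move: (b2 i); rewrite bi0 expr0n /= mul0r /dot3 => /esym ww.
  have sq0 (a : R) : a ^+ 2 = 0 -> a = 0 by move/eqP; rewrite sqrf_eq0 => /eqP.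
  have e1 := sqr_ge0 (w i).1.1; have e2 := sqr_ge0 (w i).1.2; have e3 := sqr_ge0 (w i).2.
  have -> : (w i).1.1 = 0 by apply: sq0; lra.
  have -> : (w i).1.2 = 0 by apply: sq0; lra.
  have -> : (w i).2 = 0 by apply: sq0; lra.
  by rewrite !mul0r !addr0.
apply: (@sphere_bound R n b u) => //.
- by move=> i; apply: sqrtr_ge0.
- rewrite -t1; apply: ler_sum => i _.
  by rewrite -ler_sqr ?nnegrE ?sqrtr_ge0 // b2 wt.
- move=> i; rewrite /u; have [bi0|bi0] := eqVneq (b i) 0; first by rewrite /dot3 /=; ring.
  transitivity (dot3 (w i) (w i) / b i ^+ 2); first by rewrite /dot3 /=; field.
  by rewrite b2 divff // -b2 sqrf_eq0.
- move=> y yy.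
  have yP : y.1.1 ^+ 2 + y.1.2 ^+ 2 + y.2 ^+ 2 = 1 by rewrite -yy /dot3; ring.
  have : r <= \sum_(i < n) `|dot3 (w i) y|.
    apply: (@simulation_bound _ _ _ _ (exist _ y yP) _ _ sim) => c.
    rewrite bloch_Pr_elem /=.
    by have -> : dot3 (y.1.1, y.1.2, y.2) y = 1 by []; rewrite mulr1.
  move=> /le_trans; apply; apply: ler_sum => i _.
  by rewrite wu normrM ger0_norm ?sqrtr_ge0.
Qed.

Lemma simulable_circle_bound n (r : R) : simulable_p n r -> r <= 2 / pi - 640^-1 / n%:R ^+ 2.
Proof.
move=> [Pi [povm sim]]; have n0 := povm_size_gt0 povm.
have [t0 wt t1] := povm_bloch povm.
(* Only the projection to the xz plane is tested, and projecting does not increase the norm. *)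
pose w i : R * R := ((bloch_vector (Pi i)).1.1, (bloch_vector (Pi i)).2).
pose b i := Num.sqrt (dot2 (w i) (w i)).
have ww0 (v : R * R) : 0 <= dot2 v v by rewrite /dot2 -!expr2 !addr_ge0 ?sqr_ge0.
pose u i : R * R := if b i == 0 then (1, 0) else ((w i).1 / b i, (w i).2 / b i).
have b2 i : b i ^+ 2 = dot2 (w i) (w i) by rewrite sqr_sqrtr ?ww0.
have wu i y : dot2 (w i) y = b i * dot2 (u i) y.
  rewrite /u; have [bi0|bi0] := eqVneq (b i) 0; last by rewrite /dot2 /=; field.
  move: (b2 i); rewrite bi0 expr0n /= mul0r /dot2 => /esym ww.
  have sq0 (a : R) : a ^+ 2 = 0 -> a = 0 by move/eqP; rewrite sqrf_eq0 => /eqP.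
  have e1 := sqr_ge0 (w i).1; have e2 := sqr_ge0 (w i).2.
  have -> : (w i).1 = 0 by apply: sq0; lra.
  have -> : (w i).2 = 0 by apply: sq0; lra.
  by rewrite !mul0r !addr0.
apply: (@circle_bound R n b u) => //.
- by move=> i; apply: sqrtr_ge0.
- rewrite -t1; apply: ler_sum => i _.
  rewrite -ler_sqr ?nnegrE ?sqrtr_ge0 // b2; apply: le_trans (wt i).
  rewrite /w /dot3 /dot2; case: (bloch_vector _) => [[a c] d] /=.
  by have := sqr_ge0 c; lra.
- move=> i; rewrite /u; have [bi0|bi0] := eqVneq (b i) 0; first by rewrite /dot2 /=; ring.
  transitivity (dot2 (w i) (w i) / b i ^+ 2); first by rewrite /dot2 /=; field.
  by rewrite b2 divff // -b2 sqrf_eq0.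
- move=> y yy.
  have yP : y.1 ^+ 2 + y.2 ^+ 2 = 1 by rewrite -yy /dot2; ring.
  have : r <= \sum_(i < n) `|dot3 (bloch_vector (Pi i)) (y.1, 0, y.2)|.
    apply: (@simulation_bound _ _ _ _ (exist _ y yP) _ _ sim) => c.
    rewrite bloch_Pr_elem /=.
    have -> : dot3 (y.1, 0, y.2) (y.1, 0, y.2) = 1 by rewrite -yy /dot3 /dot2 /=; ring.
    by rewrite mulr1.
  move=> /le_trans; apply; apply: ler_sum => i _.
  have -> : dot3 (bloch_vector (Pi i)) (y.1, 0, y.2) = dot2 (w i) y.
    by rewrite /dot3 /dot2 /=; ring.
  by rewrite wu normrM ger0_norm ?sqrtr_ge0.
Qed.

End BlochVectors.
(** * Assemblages of the noisy singlet *)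

Section WernerAssemblage.
Variable R : realType.
Local Open Scope complex_scope.
Local Notation C := R[i].
Local Notation idx k i := (@mxtens_index 2 2 (k : 'I_2, i : 'I_2)).

Lemma adjE m n (A : 'M[C]_(m, n)) i j : adj A i j = Num.conj (A j i).
Proof. by rewrite !mxE. Qed.

Lemma adj_mul m n p (A : 'M[C]_(m, n)) (B : 'M[C]_(n, p)) :
  adj (A *m B) = adj B *m adj A.
Proof. by rewrite /adj map_mxM trmx_mul. Qed.

Lemma psd_gram m n (A : 'M[C]_(m, n)) : psd (adj A *m A).
Proof.
move=> v; rewrite mulmxA -adj_mul -mulmxA mxE sumr_ge0 // => i _.
by rewrite adjE mulrC mul_conjC_ge0.
Qed.

Lemma psd_scale m (a : R) (A : 'M[C]_m) : 0 <= a -> psd A -> psd (a%:C *: A).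
Proof.
move=> a0 psdA v; rewrite -scalemxAr -scalemxAl mxE mulr_ge0 //.
by rewrite ler0c.
Qed.

Lemma ord2_ind (P : 'I_2 -> Prop) : P 0 -> P 1 -> forall i, P i.
Proof.
move=> P0 P1 [[|[|//]] i2].
- by rewrite (_ : Ordinal i2 = 0) //; apply: val_inj.
- by rewrite (_ : Ordinal i2 = 1) //; apply: val_inj.
Qed.

Lemma sum_ord2 (V : zmodType) (F : 'I_2 -> V) : \sum_(i < 2) F i = F 0 + F 1.
Proof.
rewrite !big_ord_recl big_ord0 addr0; congr (F _ + F _); exact: val_inj.
Qed.

Lemma ndotsigmaE (x y z : R) :
  [/\ ndotsigma x y z 0 0 = z%:C, ndotsigma x y z 0 1 = x%:C - 'i * y%:C,
      ndotsigma x y z 1 0 = x%:C + 'i * y%:C & ndotsigma x y z 1 1 = - z%:C].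
Proof. by split; rewrite mxE. Qed.

(** At r = 1 the effects are orthogonal projections; written as Gram matrices they are visibly
    positive. *)
Lemma Pr_elem1_gram (x y z : R) b : x ^+ 2 + y ^+ 2 + z ^+ 2 = 1 ->
  adj (Pr_elem 1 x y z b) *m Pr_elem 1 x y z b = Pr_elem 1 x y z b.
Proof.
move=> xyz; have half : 2^-1 = (2^-1 : R)%:C by rewrite fmorphV rmorph_nat.
have conjE (u v : R) : Num.conj (Complex u v) = Complex u (- v) by [].
have [n00 n01 n10 n11] := ndotsigmaE x y z.
have PE i j : Pr_elem 1 x y z b i j = (2^-1 : R)%:C *
   ((i == j)%:R + ((if b then 1 else -1) * 1)%:C * ndotsigma x y z i j).
  by rewrite /Pr_elem half [LHS]mxE [X in _ * X]mxE [X in _ * (X + _)]mxE [X in _ * (_ + X)]mxE.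
case: b PE => PE; apply/matrixP; elim/ord2_ind; elim/ord2_ind;
  rewrite mxE sum_ord2 !adjE !PE ?n00 ?n01 ?n10 ?n11 /=;
  apply/eqP; rewrite eq_complex /=; apply/andP; split; apply/eqP; rewrite /=; lra.
Qed.

Lemma Pfam_sum (r : R) (v : unit_vec R) : \sum_b Pfam r v b = 1%:M.
Proof.
rewrite big_bool /= /Pfam /Pr_elem -scalerDr mul1r mulN1r rmorphN scaleNr addrACA subrr addr0.
by rewrite scalerDr -scalerDl -[2^-1]div1r -splitr scale1r.
Qed.

Lemma Pfam1_povm (v : unit_vec R) : qubit_povm (Pfam 1 v).
Proof.
split=> [b|].
  by rewrite /Pfam -Pr_elem1_gram; [apply: psd_gram|case: v].
exact: Pfam_sum.
Qed.

Lemma sum_tens (V : zmodType) (F : 'I_(2 * 2) -> V) :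
  \sum_k F k = \sum_(i < 2) \sum_(j < 2) F (idx i j).
Proof.
rewrite pair_bigA /= (reindex (@mxtens_index 2 2)) /=; last first.
  by exists (@mxtens_unindex 2 2) => ij _; [exact: mxtens_indexK|exact: mxtens_unindexK].
by apply: eq_bigr => -[i j].
Qed.

Lemma mul_ket_tens m (Y : 'M[C]_(m, 2 * 2)) k i (j : 'I_2) :
  (Y *m (ket R k *t (1%:M : 'M[C]_2))) i (mxtens_index (0 : 'I_1, j)) = Y i (idx k j).
Proof.
rewrite mxE sum_tens (bigD1 k) //= (bigD1 j) //=.
rewrite tensmxE [ket R k k 0]mxE [1%:M j j]mxE !eqxx !mulr1.
rewrite big1 ?addr0 => [|l lj]; last first.
  by rewrite tensmxE [1%:M l j]mxE (negbTE lj) !mulr0.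
rewrite big1 ?addr0 // => l lk; rewrite big1 // => a _.
by rewrite tensmxE [ket R k l 0]mxE (negbTE lk) mul0r mulr0.
Qed.

Lemma bra_tens_mul n (Y : 'M[C]_(2 * 2, n)) k (i : 'I_2) j :
  ((adj (ket R k) *t (1%:M : 'M[C]_2)) *m Y) (mxtens_index (0 : 'I_1, i)) j = Y (idx k i) j.
Proof.
have -> : adj (ket R k) *t (1%:M : 'M[C]_2) = (ket R k *t (1%:M : 'M[C]_2))^T.
  rewrite trmx_tens trmx1; congr (_ *t _).
  by apply/matrixP => a b; rewrite adjE !mxE conjC_nat.
by rewrite -[Y in LHS]trmxK -trmx_mul mxE mul_ket_tens mxE.
Qed.

Lemma ptraceAE (Y : 'M[C]_(2 * 2)) (i j : 'I_2) :
  ptraceA Y i j = \sum_(k < 2) Y (idx k i) (idx k j).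
Proof.
have -> : ptraceA Y i j = ptraceA Y (mxtens_index (0 : 'I_1, i)) (mxtens_index (0 : 'I_1, j)).
  by congr (ptraceA Y _ _); apply: val_inj.
rewrite /ptraceA summxE; apply: eq_bigr => k _.
by rewrite mul_ket_tens bra_tens_mul.
Qed.

Lemma omegaE (r : R) a i k j : omega r (idx a i) (idx k j) =
  r%:C * (2^-1 * (((a == 0) && (i == 1))%:R - ((a == 1) && (i == 0))%:R)
      * (((k == 0) && (j == 1))%:R - ((k == 1) && (j == 0))%:R))
    + (1 - r%:C) / 4 * ((a == k) && (i == j))%:R.
Proof.
have psiE b l : psi_minus R (idx b l) 0 = ((Num.sqrt (2 : R))^-1)%:C *
    (((b == 0) && (l == 1))%:R - ((b == 1) && (l == 0))%:R).
  have col1 : (0 : 'I_(1 * 1)) = mxtens_index (0 : 'I_1, 0 : 'I_1) by apply: val_inj.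
  rewrite /psi_minus mxE; congr (_ * _).
  rewrite mxE [X in _ + X]mxE (col1 : (0 : 'I_1) = _) !tensmxE !mxE !eqxx !andbT.
  by rewrite -!natrM !mulnb.
have sq : ((Num.sqrt (2 : R))^-1)%:C * ((Num.sqrt (2 : R))^-1)%:C = 2^-1 :> C.
  by rewrite -rmorphM -expr2 exprVn sqr_sqrtr // fmorphV rmorph_nat.
rewrite /omega mxE [X in X + _]mxE [X in _ + X]mxE [X in r%:C * X]mxE big_ord1 adjE !psiE.
rewrite [1%:M _ _]mxE (can_eq (@mxtens_indexK 2 2)) xpair_eqE.
have conj_bool (p q : bool) : Num.conj (p%:R - q%:R : C) = p%:R - q%:R.
  by rewrite rmorphB /= !conjC_nat.
have -> : ((1 - r) / 4)%:C = (1 - r%:C) / 4.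
  by rewrite rmorphM fmorphV rmorph_nat rmorphB rmorph1.
rewrite rmorphM /= conj_bool; congr (_ * _ + _).
have -> : Num.conj ((Num.sqrt (2 : R))^-1)%:C = ((Num.sqrt (2 : R))^-1)%:C by apply: conjc_real.
by rewrite -sq; ring.
Qed.

Lemma assemblageE (r : R) X (A : finType) (M : X -> A -> 'M[C]_2) x a i j :
  assemblage (omega r) M x a i j
   = \sum_(k < 2) \sum_(l < 2) M x a k l * omega r (idx l i) (idx k j).
Proof.
rewrite /assemblage ptraceAE; apply: eq_bigr => k _.
rewrite mxE sum_tens; apply: eq_bigr => l _.
rewrite (bigD1 i) //= tensmxE mxE eqxx mulr1 big1 ?addr0 // => m mi.
by rewrite tensmxE [X in _ * X * _]mxE eq_sym (negbTE mi) mulr0 mul0r.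
Qed.

(** In matrix form s = r / 2 (tr(m) 1 - m) + (1 - r) / 4 tr(m) 1: the singlet reverses the Bloch
    vector of m, the noise keeps only its trace. *)
Lemma assemblage_entries (r : R) X (A : finType) (M : X -> A -> 'M[C]_2) x a :
  let s := assemblage (omega r) M x a in let m := M x a in
  let t := (1 - r%:C) / 4 * (m 0 0 + m 1 1) in
  [/\ s 0 0 = r%:C * 2^-1 * m 1 1 + t, s 0 1 = - (r%:C * 2^-1 * m 0 1),
      s 1 0 = - (r%:C * 2^-1 * m 1 0) & s 1 1 = r%:C * 2^-1 * m 0 0 + t].
Proof.
have E10 : ((1 : 'I_2) == 0) = false by [].
have E01 : ((0 : 'I_2) == 1) = false by [].
rewrite /=; split; rewrite assemblageE !sum_ord2 !omegaE !eqxx ?E10 ?E01 /=.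
all: rewrite ?(mulr1n, mulr0n, subr0, sub0r, mulr0, mul0r, mulr1, mulrN, addr0, add0r, mulrNN, oppr0).
all: move: (M x a 0 0) (M x a 0 1) (M x a 1 0) (M x a 1 1) (r%:C / 2) ((1 - r%:C) / 4).
all: by move=> m00 m01 m10 m11 c d; ring.
Qed.

Lemma werner_diag_identity (F : numFieldType) (r e z : F) :
  r / 2 * (2^-1 * (1 + e * - z)) + (1 - r) / 4 * (2^-1 * (1 + e * z) + 2^-1 * (1 + e * - z))
    = 2^-1 * (2^-1 * (1 + - e * r * z)).
Proof. by field. Qed.

Lemma werner_antidiag_identity (F : numFieldType) (r e w : F) :
  - (r / 2 * (2^-1 * (0 + e * w))) = 2^-1 * (2^-1 * (0 + - e * r * w)).
Proof. by field. Qed.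

(* Measuring along n prepares the opposite direction on the other side of the singlet. *)
Lemma assemblage_omega (r : R) (v : unit_vec R) b :
  assemblage (omega r) (Pfam 1) v b = 2^-1 *: Pfam r v (~~ b).
Proof.
pose e (c : bool) : C := if c then 1 else -1.
have eN : e (~~ b) = - e b by rewrite /e; case: b; rewrite //= opprK.
pose N := ndotsigma (sval v).1.1 (sval v).1.2 (sval v).2.
have PE (s : R) c i j : Pfam s v c i j = 2^-1 * ((i == j)%:R + e c * s%:C * N i j).
  rewrite /Pfam /Pr_elem -/N [LHS]mxE [X in _ * X]mxE [X in _ * (X + _)]mxE [X in _ * (_ + X)]mxE.
  by rewrite rmorphM /e; case: c; rewrite ?rmorphN rmorph1.
have PE1 c i j : Pfam 1 v c i j = 2^-1 * ((i == j)%:R + e c * N i j).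
  by rewrite PE rmorph1 mulr1.
have [n00 _ _ n11] := ndotsigmaE (sval v).1.1 (sval v).1.2 (sval v).2.
have N11 : N 1 1 = - N 0 0 by rewrite /N n00 n11.
have E10 : ((1 : 'I_2) == 0) = false by [].
have E01 : ((0 : 'I_2) == 1) = false by [].
have [s00 s01 s10 s11] := assemblage_entries r (Pfam 1) v b.
apply/matrixP; elim/ord2_ind; elim/ord2_ind; rewrite [RHS]mxE PE eN.
- by rewrite s00 !PE1 N11 eqxx; exact: werner_diag_identity.
- by rewrite s01 PE1 E01; exact: werner_antidiag_identity.
- by rewrite s10 PE1 E10; exact: werner_antidiag_identity.
- have N00 : N 0 0 = - N 1 1 by rewrite N11 opprK.
  rewrite s11 [Pfam 1 v b 0 0 + _]addrC !PE1 N00 eqxx; exact: werner_diag_identity.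
Qed.

Lemma LHS_simulable n (r : R) :
  has_LHS n (assemblage (omega r) (@Pfam R 1)) -> simulable n r.
Proof.
move=> [p [rho [q [p0 [p1 [st [q0 [q1 sigmaE]]]]]]]].
have two : 2 = (2 : R)%:C by rewrite rmorph_nat.
(* The average hidden state is the reduced state 1/2 of the noisy singlet, hence the factor 2. *)
exists (fun i => (2 * p i)%:C *: rho i); split; [split|].
- by move=> i; apply: psd_scale; [rewrite mulr_ge0|case: (st i)].
- have e3 : (0 : R) ^+ 2 + 0 ^+ 2 + 1 ^+ 2 = 1 by ring.
  pose v : unit_vec R := exist _ (0, 0, 1) e3.
  have : \sum_b assemblage (omega r) (@Pfam R 1) v b = \sum_(i < n) (p i)%:C *: rho i.
    under eq_bigr do rewrite sigmaE.
    rewrite exchange_big /=; apply: eq_bigr => i _.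
    by rewrite -scaler_suml -rmorph_sum -big_distrl /= q1 mul1r.
  rewrite big_bool /= !assemblage_omega /= -scalerDr => sumE.
  under eq_bigr do rewrite rmorphM -scalerA /= -two.
  rewrite -scaler_sumr -sumE scalerA mulfV ?pnatr_eq0 // scale1r.
  by rewrite addrC -(Pfam_sum r v) big_bool.
(* Exchanging the outcomes undoes the reversal of direction by the singlet. *)
- exists (fun x a => q x (~~ a)); split; [|split] => //.
    by move=> x i; rewrite -(q1 x i) !big_bool /=; apply: addrC.
  move=> x a; have := sigmaE x (~~ a); rewrite assemblage_omega negbK.
  move=> /(congr1 (fun M => 2 *: M)); rewrite scalerA mulfV ?pnatr_eq0 // scale1r => ->.
  rewrite scaler_sumr; apply: eq_bigr => i _.
  by rewrite two !scalerA -!rmorphM; congr (_%:C *: _); ring.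
Qed.

Lemma Nr_le_gamma (r : R) : (Nr r <= gamma (omega r))%E.
Proof.
apply: ereal_inf_le_tmp => _ [n LHS <-]; exists n => //.
apply: LHS_simulable; apply: LHS; exact: Pfam1_povm.
Qed.

End WernerAssemblage.

(** * From the 1 / n^2 bounds to the stated rates *)

Section Rates.
Variable R : realType.

(** The sign condition on x covers the empty set, whose [sup] is 0 by convention. *)
Lemma sup_le_ge0 (S : set R) (x : R) : 0 <= x -> (forall r, S r -> r <= x) -> sup S <= x.
Proof.
move=> x0 Sx; have [->|/set0P S0] := eqVneq S set0; first by rewrite sup0.
exact: ge_sup.
Qed.

Lemma powR_le_invX2 (n : nat) (a : R) : (0 < n)%N -> a <= - 2 -> n%:R `^ a <= (n%:R ^+ 2)^-1.
Proof.
move=> n0 a2; rewrite -powR_invn ?ler0n //.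
by apply: ler_powR; rewrite ?ler1n.
Qed.

(** With d = 1/2 - r < 1, the square of d^(-2/5) is at most 1 / d <= 288 n^2, which is below (20
    n)^2. *)
Lemma Nr_lower_bound (r : R) : 0 <= r -> r < 1 / 2 ->
  ((20^-1 * (1 / 2 - r) `^ (- (2 / 5)))%:E <= Nr r)%E.
Proof.
move=> r0 r2; apply: le_ereal_inf_tmp => _ [n sim <-]; rewrite lee_fin.
have n0 : (0 < n)%N by case: (sim) => Pi [/povm_size_gt0].
have := simulable_sphere_bound sim; set d := 1 / 2 - r => rn.
have d0 : 0 < d by rewrite /d; lra.
have n2 : 0 < n%:R ^+ 2 :> R by rewrite exprn_gt0 ?ltr0n.
set D := d `^ _; have D2 : D ^+ 2 <= d^-1.
  rewrite /D -powR_mulrn ?powR_ge0 // -powRrM -[leRHS]powR_inv1 ?(ltW d0) //.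
  by apply: ger_powR; [rewrite d0 /d /=|]; lra.
have : d^-1 <= 288 * n%:R ^+ 2.
  rewrite -div1r ler_pdivrMr //.
  have : 288^-1 / n%:R ^+ 2 <= d by rewrite /d; lra.
  by rewrite ler_pdivrMr //; lra.
move=> /(le_trans D2) Dn.
rewrite mulrC ler_pdivrMr // -ler_sqr ?nnegrE ?powR_ge0 ?mulr_ge0 //.
by apply: le_trans Dn _; rewrite exprMn mulrC ler_pM2l //; lra.
Qed.

End Rates.

Theorem theorem1 (R : realType) :
  (exists c3 c2 : R, 0 < c3 /\ 0 < c2 /\
     forall n : nat, (0 < n)%N ->
       Rn R n <= 1 / 2 - c3 * (n%:R `^ (- (5 / 2))) /\
       Rpn R n <= 2 / pi - c2 * (n%:R `^ (- 4))) /\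
  (exists c : R, 0 < c /\
     forall r : R, 0 <= r -> r < 1 / 2 ->
       (Nr r <= gamma (omega r))%E /\
       ((c * (1 / 2 - r) `^ (- (2 / 5)))%:E < Nr r)%E).
Proof.
split.
  exists 288^-1, 640^-1; split; first by lra.
  split; first by lra.
  move=> n n0; have n2 : 0 < n%:R ^+ 2 :> R by rewrite exprn_gt0 ?ltr0n.
  have nV1 : (n%:R ^+ 2)^-1 <= 1 :> R by rewrite invf_le1 // exprn_ege1 ?ler1n.
  have nV0 : 0 <= (n%:R ^+ 2)^-1 :> R by rewrite invr_ge0 ltW.
  split.
    have := @powR_le_invX2 R n (- (5 / 2)) n0; move=> /(_ ltac:(lra)).
    set a := n%:R `^ _ => an.
    apply: sup_le_ge0 => [|r /simulable_sphere_bound]; lra.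
  have := @powR_le_invX2 R n (- 4) n0; move=> /(_ ltac:(lra)).
  set a := n%:R `^ _ => an.
  (* Keeps the bound nonnegative, as [sup_le_ge0] requires. *)
  have p2 : 1 / 2 <= 2 / pi :> R.
    by rewrite ler_pdivlMr ?pi_gt0 //; have := pihalf_lt2 R; lra.
  apply: sup_le_ge0 => [|r /simulable_circle_bound]; lra.
(* Half of the constant 1/20, to make the inequality strict. *)
exists 40^-1; split; first by rewrite invr_gt0.
move=> r r0 r2; split; first exact: Nr_le_gamma.
apply: lt_le_trans (Nr_lower_bound r0 r2); rewrite lte_fin ltr_pM2r; first lra.
by apply: powR_gt0; lra.
Qed.
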